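(* The anti-forcing spectrum of an even polygonal chain can be determined in linear time; that is, there is an algorithm which, given an even polygonal chain $G$, outputs the set $\mathrm{Spec}_{af}(G)=\{af(G,M): M\text{ is a perfect matching of }G\}$ in time linear in the size of $G$.
   Context: All graphs are finite and simple. For a perfect matching $M$ of $G$, a set $S\subseteq E(G)\setminus M$ is an anti-forcing set of $M$ if $M$ is the unique perfect matching of $G-S$; $af(G,M)$ is the minimum cardinality of an anti-forcing set of $M$. A connected plane graph is outerplane if all its vertices lie on the boundary of the exterior face. A face cycle is the boundary of an interior face when it is a cycle; two face cycles are adjacent if they share an edge. An even polygonal chain is a 2-connected plane bipartite graph that is outerplane and in which each face cycle is adjacent to at most two other face cycles. The size of $G$ is its number of vertices and edges. *)

(* Defs.v *)
From mathcomp Require Import all_boot all_fingroup.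

Set Implicit Arguments.
Unset Strict Implicit.
Unset Printing Implicit Defensive.

Record sgraph := SGraph {
  nv : nat;
  adj : rel 'I_nv;
  adj_sym : symmetric adj;
  adj_irrefl : irreflexive adj }.

Notation vert G := 'I_(nv G).

Section Graph.
Variable G : sgraph.
Implicit Types (A : {set vert G}) (C F M S : {set {set vert G}}).

Definition edges : {set {set vert G}} :=
  [set [set p.1; p.2] | p : vert G * vert G & adj p.1 p.2].

Definition gsize : nat := nv G + #|edges|.

Definition connected_in A : bool :=
  [forall x in A, forall y in A,
     connect [rel a b | [&& a \in A, b \in A & adj a b]] x y].

Definition connected : bool := connected_in [set: vert G].

Definition two_connected : bool :=
  [&& 2 < nv G, connected & [forall v, connected_in [set~ v]]].

Definition bipartite : Prop :=
  exists col : vert G -> bool, forall u v, adj u v -> col u != col v.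

Definition is_cycle C : Prop :=
  exists c : seq (vert G),
    [/\ 2 < size c, ucycle (@adj G) c
      & C = [set [set x; next c x] | x in c]].

(* M is a perfect matching of the spanning subgraph with edge set F. *)
Definition perfect_matching F M : bool :=
  (M \subset F) && [forall v, #|[set e in M | v \in e]| == 1].

Definition anti_forcing_set M S : bool :=
  (S \subset edges :\: M) &&
  ([set M' | perfect_matching (edges :\: S) M'] == [set M]).

(* The default value edges :\: M is itself an anti-forcing set when M is a
   perfect matching: see anti_forcing_setT and afP below. *)
Definition af M : nat :=
  #|[arg min_(S < edges :\: M | anti_forcing_set M S) #|S| ]|.

Definition spec_af : {pred nat} :=
  [pred k | [exists M, perfect_matching edges M && (af M == k)]].

Lemma anti_forcing_setT M :
  perfect_matching edges M -> anti_forcing_set M (edges :\: M).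
Proof.
case/andP=> sME /forallP M1; rewrite /anti_forcing_set subxx /=.
have EM : edges :\: (edges :\: M) = M by rewrite setDDr setDv set0U; apply/setIidPr.
apply/eqP/setP => M'; rewrite !inE EM; apply/idP/eqP => [/andP[sM'M /forallP M'1]|->]; last first.
  by rewrite /perfect_matching subxx; apply/forallP.
apply/eqP; rewrite eqEsubset sM'M /=; apply/subsetP => e eM.
have [v ve] : exists v, v \in e.
  have /imsetP[p _ ->] := subsetP sME e eM.
  by exists p.1; rewrite !inE eqxx.
have /cards1P[e1 De1] := M1 v; have /cards1P[e2 De2] := M'1 v.
have : e2 \in [set e2] by rewrite inE.
rewrite -De2 inE => /andP[e2M' ve2].
have : e2 \in [set e1] by rewrite -De1 inE ve2 (subsetP sM'M).
have : e \in [set e1] by rewrite -De1 inE eM.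
by rewrite !inE => /eqP-> /eqP<-.
Qed.

Lemma afP M : perfect_matching edges M ->
  (exists2 S, anti_forcing_set M S & #|S| = af M) /\
  (forall S, anti_forcing_set M S -> af M <= #|S|).
Proof.
move=> pM; rewrite /af; case: arg_minnP; first exact: anti_forcing_setT.
by move=> S afS minS; split=> //; exists S.
Qed.

End Graph.

(* A connected plane graph is a rotation system of genus 0.
   [rot u] lists the neighbours of u in their cyclic order around u (its values
   at non-neighbours are irrelevant).  A dart is an ordered pair (u, v) of
   adjacent vertices.  The walk along the boundary of a face that traverses
   (u, v) continues with (v, rot v u), and the faces are the orbits of
   this map.  By Euler's formula, a rotation system of a connected graph is
   realised by an embedding in the plane iff V + F = E + 2.  Recording the
   exterior face by one of its darts only leaves out the one-vertex graph. *)
Definition dart_next n (rot : 'I_n -> 'S_n) (d : 'I_n * 'I_n) : 'I_n * 'I_n :=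
  (d.2, rot d.2 d.1).

Definition dart_face n (rot : 'I_n -> 'S_n) (d : 'I_n * 'I_n) :
  {set 'I_n * 'I_n} := [set x | fconnect (dart_next rot) d x].

Definition dart_faces n (e : rel 'I_n) (rot : 'I_n -> 'S_n) :
  {set {set 'I_n * 'I_n}} :=
  [set dart_face rot d | d : 'I_n * 'I_n & e d.1 d.2].

Record plane_graph := PlaneGraph {
  graph_of :> sgraph;
  rot : vert graph_of -> 'S_(nv graph_of);
  outer_dart : vert graph_of * vert graph_of;
  rotP : forall u v, adj u v -> porbit (rot u) v = [set w | adj u w];
  outer_dartP : adj outer_dart.1 outer_dart.2;
  plane_connected : connected graph_of;
  euler_formula : nv graph_of + #|dart_faces (@adj graph_of) rot|
                  = #|edges graph_of| + 2 }.

Section Plane.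
Variable G : plane_graph.
Implicit Types (f : {set vert G * vert G}) (C D : {set {set vert G}}).

Definition faces := dart_faces (@adj G) (@rot G).
Definition outer_face := dart_face (@rot G) (outer_dart G).

Definition boundary f : {set {set vert G}} := [set [set d.1; d.2] | d in f].

Definition outerplane : Prop :=
  forall v : vert G, exists2 e, e \in boundary outer_face & v \in e.

Definition face_cycle C : Prop :=
  is_cycle C /\ exists2 f, f \in faces :\ outer_face & boundary f = C.

Definition cycle_adjacent C D : Prop := C != D /\ C :&: D != set0.

Definition even_polygonal_chain : Prop :=
  [/\ two_connected G, bipartite G, outerplane
    & forall C, face_cycle C ->
      forall Ds : seq {set {set vert G}}, uniq Ds ->
      (forall D, D \in Ds -> face_cycle D /\ cycle_adjacent C D) ->
      size Ds <= 2].

(* The doubly connected edge list of G: the half-edges are numbered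
   0, ..., 2m - 1 in an arbitrary order ds, and the input consists of the number
   of vertices, the number 2m of half-edges, a half-edge of the exterior face,
   and the three arrays giving the origin, the twin and the successor along
   its face of every half-edge. *)
Definition dart_numbering (ds : seq (vert G * vert G)) : Prop :=
  uniq ds /\ forall d, (d \in ds) = adj d.1 d.2.

Definition dcel (ds : seq (vert G * vert G)) : seq nat :=
  [:: nv G; size ds; index (outer_dart G) ds]
  ++ [seq val d.1 | d <- ds]
  ++ [seq index (d.2, d.1) ds | d <- ds]
  ++ [seq index (dart_next (@rot G) d) ds | d <- ds].

End Plane.

(* A unit-cost RAM with registers R[0], R[1], ... (only those mentioned in the
   program matter) and a memory with indirect addressing; there is no
   multiplication, and the machine halts by leaving the program. *)
Inductive instr :=
| Const of nat & nat
| Add of nat & nat & nat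
| Sub of nat & nat & nat
| Read of nat & nat
| Write of nat & nat
| Jz of nat & nat.

Definition program := seq instr.

Record state := State { pc : nat; reg : nat -> nat; mem : nat -> nat }.

Definition halted (P : program) (s : state) : bool := size P <= pc s.

Definition exec (i : instr) (s : state) : state :=
  let: State p R m := s in
  match i with
  | Const r k => State p.+1 [eta R with r |-> k] m
  | Add r a b => State p.+1 [eta R with r |-> R a + R b] m
  | Sub r a b => State p.+1 [eta R with r |-> R a - R b] m
  | Read r a => State p.+1 [eta R with r |-> m (R a)] m
  | Write a r => State p.+1 R [eta m with R a |-> R r]
  | Jz r l => State (if R r == 0 then l else p.+1) R m
  end.

Definition step (P : program) (s : state) : state :=
  if onth P (pc s) is Some i then exec i s else s.

(* The input occupies the memory from address 0 on; everything else is 0. *)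
Definition init (inp : seq nat) : state := State 0 (fun=> 0) (nth 0 inp).

(* Upon halting, R[0] is the length of the output and R[1] its address. *)
Definition output_is (s : state) (out : seq nat) : Prop :=
  reg s 0 = size out /\ forall i, i < size out -> mem s (reg s 1 + i) = nth 0 out i.

Definition words_le (W : nat) (s : state) : Prop :=
  forall i, reg s i <= W /\ mem s i <= W.

(* On input inp, P halts with output out within time T, all the numbers
   occurring in the computation (hence all the addresses) being at most W:
   the words have O(log W) bits, so that for W polynomial in the size of the
   input no long arithmetic is hidden in the unit cost. *)
Definition computes_within (P : program) (T W : nat) (inp out : seq nat) : Prop :=
  exists t, [/\ t <= T,
    halted P (iter t (step P) (init inp)),
    forall u, u <= t -> words_le W (iter u (step P) (init inp))
  & output_is (iter t (step P) (init inp)) out].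

(* Main.v *)
(* By Euler's formula the faces of a plane graph span its cycle space over F_2.
   For a 2-connected bipartite outerplane graph this identifies the perfect
   matchings with the 0-1 valuations of the inner faces that satisfy one
   inequality per chord: an edge is matched iff the face on its left, as seen
   from its vertex of colour true, has value 1 and the one on its right value 0.
   In an even polygonal chain the inner faces form a path, so a perfect matching
   is a 0-1 word with forbidden pairs of neighbours.  An anti-forcing set acts on
   such words by fixing letters (an edge of the exterior cycle) and by excluding
   pairs of letters (a chord), and the least number of these that isolates a
   given word is computed by a scan with the state (last letter, d), d <= 2.
   The sets of values reachable in each state stay intervals all along the scan;
   hence the spectrum is an interval, and its two ends are obtained by updating
   seven numbers at every face. *)
Require Import Defs.
From mathcomp Require Import all_boot all_fingroup all_algebra zify.

Set Implicit Arguments.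
Unset Strict Implicit.
Unset Printing Implicit Defensive.

(** A plane graph is only a rotation system here, so no Jordan curve is at hand. Its substitute is a
    rank count over F_2: Euler's formula makes every edge set that meets all faces evenly a cut, in
    particular the edges that a closed walk in the dual crosses an odd number of times. A cut inside
    the star of a vertex can be played against 2-connectedness, and a nonempty cut made of chords
    contradicts that the outer walk meets all vertices. So inner faces are bounded by cycles and
    form a tree, which is a path for a chain. Excluding one exterior edge fixes a letter because the
    exterior edges of one parity on a face are matched together. A scan that kept only the least
    cost a would fail: a later edge can settle an earlier letter as well, and d is what is saved by
    leaving the last letter open. Merged intervals form an interval only if they leave no gap, so
    inequalities between their ends are carried through the induction. The time is linear since the
    faces met on a walk have disjoint sets of darts. *)

(** * Words along a chain *)

(* Along the chain, the letter p k tells whether the edges of the exterior cycle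
   on face k that are matched are those whose place along the face has the parity
   of the entry chord, and [exit_bit (t k) (p k)] says the same of the exit chord;
   both letters are true at a matched chord and they are never both false.
   A Tight face is a square crossed between opposite edges: it has no exterior
   edge of the parity of its chords, so that p k = false cannot be fixed there. *)
Inductive face_type := Mono | Turn | Tight.

Definition exit_bit (t : face_type) (p : bool) : bool :=
  if t is Mono then ~~ p else p.

(* In the state (a, d) after face k, a is the least cost that forces the word
   up to k and a - d the least cost that forces it among the words with the same
   k-th letter. *)
Definition dp_step (t : face_type) (q p : bool) (s : nat * nat) : nat * nat :=
  let: (a, d) := s in
  if ~~ q then (a, d.-1) else
  if p then (a.+1, 1) else
  if t is Tight then (a.+1, d.+1) else (a.+1 - d, 1).

Section Chain.
Variable t : nat -> face_type.
Implicit Types (p : nat -> bool) (F B : nat -> bool).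

Local Notation out p k := (exit_bit (t k) (p k)).

Fixpoint dp p k : nat * nat :=
  if k is j.+1 then dp_step (t k) (out p j) (p k) (dp p j) else (1, 1).

Definition valid p k := forall i, i < k -> out p i || p i.+1.

(* F and B are the sets of fixed letters and of excluded chords. *)
Definition allowed p F B k :=
  (forall i, i <= k -> F i -> ~ (t i = Tight /\ ~~ p i)) /\
  (forall i, i < k -> B i -> ~~ (out p i && p i.+1)).

(** These are the words of the perfect matchings that avoid the anti-forcing set: an excluded
    exterior edge of face i is unmatched in p, which leaves only the letter [p i] there. *)
Definition rival p F B k p' :=
  [/\ valid p' k, forall i, i <= k -> F i -> p' i = p i
    & forall i, i < k -> B i -> ~~ (out p' i && p' i.+1)].

Definition forced p F B k :=
  forall p', rival p F B k p' -> forall i, i <= k -> p' i = p i.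

(** The last letter may stay open when the next face settles it; this weaker requirement is what
    makes the scan local. *)
Definition semiforced p F B k :=
  forall p', rival p F B k p' -> p' k = p k -> forall i, i <= k -> p' i = p i.

Definition cost F B k : nat := F 0 + \sum_(i < k) (B i + F i.+1).

Definition upd p k b : nat -> bool := [eta p with k |-> b].

Lemma upd_lt p k b i : i < k -> upd p k b i = p i.
Proof. by move=> ik; rewrite /upd /= (ltn_eqF ik). Qed.

Lemma upd_eq p k b : upd p k b k = b.
Proof. by rewrite /upd /= eqxx. Qed.

Lemma forced_semi p F B k : forced p F B k -> semiforced p F B k.
Proof. by move=> H p' /H. Qed.

Lemma eq_dp p p' k : (forall i, i <= k -> p i = p' i) -> dp p k = dp p' k.
Proof.
elim: k => [//|k IH] H /=; rewrite !H // IH // => i ik; exact/H/leqW.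
Qed.

Lemma eq_valid p p' k : (forall i, i <= k -> p i = p' i) -> valid p k -> valid p' k.
Proof. by move=> H v i ik; rewrite -!H ?v // ltnW. Qed.

Lemma validS p k : valid p k.+1 <-> valid p k /\ (out p k || p k.+1).
Proof.
split=> [v|[v e] i]; first by split=> [i ik|]; apply: v => //; exact: ltnW.
by rewrite ltnS leq_eqVlt => /predU1P[->|/v].
Qed.

Lemma eq_rival p F B F' B' k p' :
  (forall i, i <= k -> F i = F' i) -> (forall i, i < k -> B i = B' i) ->
  rival p F B k p' -> rival p F' B' k p'.
Proof. by move=> eF eB [v f b]; split=> // i ik; rewrite -?eF -?eB //; auto. Qed.

Lemma rivalS p F B k p' : rival p F B k.+1 p' <->
  [/\ rival p F B k p', out p' k || p' k.+1, F k.+1 -> p' k.+1 = p k.+1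
    & B k -> ~~ (out p' k && p' k.+1)].
Proof.
split=> [[/validS[v o] f b]|[[v f b] o f1 b1]].
  split=> //; [|exact: f|exact: b].
  by split=> // i ik; [apply: f; apply: leqW|apply: b; apply: leqW].
split; first by apply/validS.
  by move=> i; rewrite leq_eqVlt ltnS => /predU1P[->|/f].
by move=> i; rewrite ltnS leq_eqVlt => /predU1P[->|/b].
Qed.

Lemma rival_upd p F B k p' b : rival p F B k p' -> rival p F B k (upd p' k.+1 b).
Proof.
case=> v f bl; split=> [|i ik|i ik]; rewrite ?upd_lt ?ltnS ?(ltnW ik) //.
- by apply: (@eq_valid p') => // i ik; rewrite upd_lt.
- exact: f.
- exact: bl.
Qed.

Lemma rival_extend p F B k p' b :
    rival p F B k p' -> out p' k || b -> (F k.+1 -> b = p k.+1) ->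
    (B k -> ~~ (out p' k && b)) -> rival p F B k.+1 (upd p' k.+1 b).
Proof.
by move=> r o f bl; apply/rivalS; rewrite upd_eq upd_lt //; split=> //; apply: rival_upd.
Qed.

Lemma rival_refl p F B k : valid p k -> allowed p F B k -> rival p F B k p.
Proof. by move=> v [_ b]; split. Qed.

Lemma allowedS p F B k : allowed p F B k.+1 <->
  [/\ allowed p F B k, F k.+1 -> ~ (t k.+1 = Tight /\ ~~ p k.+1)
    & B k -> ~~ (out p k && p k.+1)].
Proof.
split=> [[f b]|[[f b] f1 b1]].
  split=> //; [|exact: f|exact: b].
  by split=> i ik; [apply: f; apply: leqW|apply: b; apply: leqW].
split=> i; first by rewrite leq_eqVlt ltnS => /predU1P[->|/f].
by rewrite ltnS leq_eqVlt => /predU1P[->|/b].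
Qed.

Lemma eq_allowed p F B F' B' k :
  (forall i, i <= k -> F i = F' i) -> (forall i, i < k -> B i = B' i) ->
  allowed p F B k -> allowed p F' B' k.
Proof. by move=> eF eB [f b]; split=> // i ik; rewrite -?eF -?eB //; auto. Qed.

Lemma costS F B k : cost F B k.+1 = cost F B k + (B k + F k.+1).
Proof. by rewrite /cost big_ord_recr /= addnA. Qed.

Lemma eq_cost F B F' B' k :
  (forall i, i <= k -> F i = F' i) -> (forall i, i < k -> B i = B' i) ->
  cost F B k = cost F' B' k.
Proof. by move=> eF eB; rewrite /cost eF //; congr addn; apply: eq_bigr => i _; rewrite eF ?eB. Qed.

(** d = 2 arises only at a [Tight] face with letter false, whose exit letter is then false, so that
    the next step lowers it. The last bound keeps a - d exact in natural numbers. *)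
Lemma dp_bound p k : valid p k ->
  [/\ (dp p k).2 <= 2, out p k -> (dp p k).2 <= 1 & (dp p k).2 <= (dp p k).1].
Proof.
elim: k => [|k IH] /=; first by [].
case/validS=> /IH; case: (dp p k) => a d /= [d2 q1 da].
case: (out p k) q1 => [/(_ isT) d1 _|_ /= ->] /=; last first.
  by split=> [||]; lia.
by case: (p k.+1); case: (t k.+1) => //=; split=> //=; lia.
Qed.

(** A rival up to [k] that tolerates the letter [p k.+1] extends by it to a rival with the right
    last letter. *)
Lemma semiforced_ext p F B k p' : semiforced p F B k.+1 ->
    rival p F B k p' -> out p' k || p k.+1 ->
    (B k -> ~~ (out p' k && p k.+1)) -> forall i, i <= k -> p' i = p i.
Proof.
move=> H r o b i ik; have e := upd_lt p' (p k.+1) (ik : i < k.+1).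
rewrite -e; apply: H; [exact: rival_extend | exact: upd_eq | exact: leqW].
Qed.

Lemma forced_ext p F B k p' b : forced p F B k.+1 ->
    rival p F B k p' -> out p' k || b -> (F k.+1 -> b = p k.+1) ->
    (B k -> ~~ (out p' k && b)) -> b = p k.+1.
Proof.
move=> H r o f bl; rewrite -[LHS](upd_eq p' k.+1); apply: H => //.
exact: rival_extend.
Qed.

Lemma out_neq p p' k : p' k != p k -> out p' k = ~~ out p k.
Proof. by rewrite /exit_bit; case: (t k); case: (p k); case: (p' k). Qed.

(** By restriction: a pair that forces or semiforces up to [k.+1] semiforces up to [k], which costs
    at least a - d. The facts [T1] and [T2] tell what it must contain besides: the new chord, the
    new letter, or full forcing up to [k], which costs at least a. *)
Lemma dp_lower p F B k : valid p k -> allowed p F B k ->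
  (forced p F B k -> (dp p k).1 <= cost F B k) /\
  (semiforced p F B k -> (dp p k).1 <= cost F B k + (dp p k).2).
Proof.
elim: k F B => [|k IH] F B.
  rewrite /cost big_ord0 addn0 /= => _ _; split; last by case: (F 0).
  move=> H; case F0: (F 0) => //.
  have /H /(_ 0 isT) : rival p F B 0 (upd p 0 (~~ p 0)).
    by split=> // i; rewrite leqn0 => /eqP->; rewrite F0.
  by rewrite upd_eq; case: (p 0).
move=> vS aS; have [v o] := (iffLR (validS _ _) vS).
have [al f1 b1] := (iffLR (allowedS _ _ _ _) aS).
have [L0 L1] := IH F B v al.
have S0 : forced p F B k.+1 -> semiforced p F B k.+1 by move=> /forced_semi.
have S1 : semiforced p F B k.+1 -> semiforced p F B k.
  by move=> H p' r e; apply: (semiforced_ext H r); rewrite e.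
have [d2 q1 da] := dp_bound v.
rewrite !costS /=; case D: (dp p k) L0 L1 d2 q1 da => [a d] /= L0 L1 d2 q1 da.
move: o q1 f1 b1; case q: (out p k); last first.
  move=> /= p1 _ f1 b1.
  have T1 : semiforced p F B k.+1 -> forced p F B k \/ B k.
    move=> H; case b: (B k); [by right | left => p' r].
    by apply: (semiforced_ext H r); rewrite ?p1 ?orbT ?b.
  have T2 : forced p F B k.+1 -> forced p F B k \/ F k.+1.
    move=> H; case f: (F k.+1); [by right | left => p' r].
    have [e|/out_neq oe] := eqVneq (p' k) (p k).
      exact: (S1 (S0 H) p' r e).
    have := @forced_ext _ _ _ _ _ false H r; rewrite oe q p1 f /=.
    by move=> /(_ isT) H1; suff: false by []; apply: H1.
  split=> H.
    have := L1 (S1 (S0 H)); case: (T1 (S0 H)) => [/L0|->]; first lia.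
    by case: (T2 H) => [/L0|->] /=; lia.
  by have := L1 (S1 H); case: (T1 H) => [/L0|->] /=; lia.
move=> _ /(_ isT) d1; case p1: (p k.+1) => f1 b1 /=.
  have T1 : semiforced p F B k.+1 -> forced p F B k.
    by move=> H p' r; apply: (semiforced_ext H r); rewrite ?p1 ?orbT // => /b1.
  have T2 : forced p F B k.+1 -> F k.+1.
    move=> H; case f: (F k.+1) => //.
    have := @forced_ext _ _ _ _ _ false H (rival_refl v al); rewrite q p1 f /=.
    by move=> /(_ isT) H1; suff: false by []; apply: H1.
  split=> H; first by have := L0 (T1 (S0 H)); rewrite (T2 H); lia.
  by have := L0 (T1 H); lia.
have T2 : forced p F B k.+1 -> F k.+1 \/ (forced p F B k /\ B k).
  move=> H; case f: (F k.+1); [by left | right].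
  have bk : B k.
    case b: (B k) => //.
    have := @forced_ext _ _ _ _ _ true H (rival_refl v al); rewrite p1 f b orbT /=.
    by move=> H1; suff: true = false by []; apply: H1.
  split=> // p' r; have [e|/out_neq oe] := eqVneq (p' k) (p k).
    exact: (S1 (S0 H) p' r e).
  have := @forced_ext _ _ _ _ _ true H r; rewrite oe q p1 f orbT /=.
  by move=> H1; suff: true = false by []; apply: H1.
have S1' H := L1 (S1 H).
case tk: (t k.+1) f1 => f1 /=; split=> H; try by have := S1' H; lia.
- by case: (T2 H) => [->|[/L0 + ->]]; have := S1' (S0 H); lia.
- by case: (T2 H) => [->|[/L0 + ->]]; have := S1' (S0 H); lia.
(* At a [Tight] face the letter false cannot be fixed; what remains is full forcing before it
   together with the chord. *)
by case: (T2 H) => [/f1 []|[/L0 + ->]] //; lia.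
Qed.

(** An optimal forcing or semiforcing pair for [k] is extended at the last face by a fixed letter,
    by an excluded chord or by nothing. The base case fixes letter 0, whence [t 0 <> Tight]. *)
Lemma dp_upper p k : t 0 <> Tight -> valid p k ->
  (exists F B, [/\ allowed p F B k, forced p F B k & cost F B k = (dp p k).1]) /\
  (exists F B, [/\ allowed p F B k, semiforced p F B k
                 & cost F B k + (dp p k).2 = (dp p k).1]).
Proof.
move=> t0; elim: k => [|k IH].
  move=> _; split.
    exists xpredT, xpred0; split; last by rewrite /cost big_ord0.
      by split=> // i; rewrite leqn0 => /eqP-> _ [/t0].
    by move=> p' [_ f _] i ik; apply: f.
  exists xpred0, xpred0; split; last by rewrite /cost big_ord0.
    by split.
  by move=> p' _ e i; rewrite leqn0 => /eqP->.
case/validS=> v o; have [[F0 [B0 [al0 g0 c0]]] [F1 [B1 [al1 g1 c1]]]] := IH v.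
have [d2 q1 da] := dp_bound v; rewrite /=.
case D: (dp p k) c0 c1 d2 q1 da => [a d] /= c0 c1 d2 q1 da.
have ext F B (f b : bool) (G : (nat -> bool) -> (nat -> bool) -> Prop) n :
    allowed p F B k -> (f -> ~ (t k.+1 = Tight /\ ~~ p k.+1)) ->
    (b -> ~~ (out p k && p k.+1)) ->
    (forall F' B', F' k.+1 = f -> B' k = b ->
       (forall p', rival p F' B' k p' -> rival p F B k p') -> G F' B') ->
    cost F B k + (b + f) = n ->
    exists F' B', [/\ allowed p F' B' k.+1, G F' B' & cost F' B' k.+1 = n].
  move=> al hf hb hG hn; exists (upd F k.+1 f), (upd B k b).
  have eF i : i <= k -> F i = upd F k.+1 f i by move=> ik; rewrite upd_lt.
  have eB i : i < k -> B i = upd B k b i by move=> ik; rewrite upd_lt.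
  split.
  - by apply/allowedS; rewrite !upd_eq; split=> //; apply: eq_allowed al.
  - apply: hG; rewrite ?upd_eq // => p'; apply: eq_rival => i ik; symmetry; auto.
  by rewrite costS !upd_eq -hn; congr addn; symmetry; apply: eq_cost.
have last i F B p' : rival p F B k.+1 p' -> i <= k.+1 ->
    (forall i, i <= k -> p' i = p i) -> p' k.+1 = p k.+1 -> p' i = p i.
  by move=> _ + H e; rewrite leq_eqVlt ltnS => /predU1P[->|/H].
have sub n m : (exists F B, [/\ allowed p F B k.+1, semiforced p F B k.+1
      & cost F B k.+1 = m]) -> m + n.2 = n.1 ->
  exists F B, [/\ allowed p F B k.+1, semiforced p F B k.+1 & cost F B k.+1 + n.2 = n.1].
  by move=> [F [B [? ? e]]] ?; exists F, B; rewrite e.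
have outE p' : (out p' k == out p k) = (p' k == p k).
  by rewrite /exit_bit; case: (t k); case: (p k); case: (p' k).
move: o q1; case q: (out p k); last first.
  move=> /= p1 _.
  split.
    apply: (ext F0 B0 false false (fun F B => forced p F B k.+1)) => //; last by rewrite c0 addn0.
    move=> F' B' _ _ sr p' r; have /rivalS[/sr r' o' _ _] := r.
    have H := g0 p' r' => i ik; apply: (last i _ _ _ r) => //.
    by move: o'; rewrite (H k) // q p1 /= => ->.
  case: d D c1 d2 da => [|d] D c1 d2 da.
    apply: (sub (a, 0) a) => /=; last by rewrite addn0.
    apply: (ext F0 B0 false false (fun F B => semiforced p F B k.+1)) => //; last by rewrite c0 addn0.
    move=> F' B' _ _ sr; apply: forced_semi => p' r; have /rivalS[/sr r' o' _ _] := r.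
    have H := g0 p' r' => i ik; apply: (last i _ _ _ r) => //.
    by move: o'; rewrite (H k) // q p1 /= => ->.
  (* When d > 0, excluding the chord, which is unmatched here, makes the exit letter of rivals with
     the right last letter false; semiforcing before it then suffices, at cost a - d + 1 instead of
     a. *)
  apply: (sub (a, d) (cost F1 B1 k + 1)) => /=; last by rewrite -c1; lia.
  apply: (ext F1 B1 false true (fun F B => semiforced p F B k.+1)) => //; first by rewrite q.
  move=> F' B' _ b' sr p' r e; have /rivalS[/sr r' _ _ /(_ b')] := r.
  rewrite e p1 andbT => o' i ik; apply: (last i _ _ _ r) => //.
  by apply: g1 => //; apply/eqP; rewrite -outE q (negbTE o').
move=> _ /(_ isT) d1; case p1: (p k.+1) => /=.
  split.
    apply: (ext F0 B0 true false (fun F B => forced p F B k.+1)) => //; last by rewrite c0 addn1.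
      by move=> _ [_]; rewrite p1.
    move=> F' B' f' _ sr p' r; have /rivalS[/sr r' _ /(_ f') e _] := r.
    by move=> i ik; apply: (last i _ _ _ r) => //; apply: g0.
  apply: (sub (a.+1, 1) a) => /=; last by rewrite addn1.
  apply: (ext F0 B0 false false (fun F B => semiforced p F B k.+1)) => //; last by rewrite c0 addn0.
  move=> F' B' f' _ sr p' r e; have /rivalS[/sr r' _ _ _] := r.
  by move=> i ik; apply: (last i _ _ _ r) => //; apply: g0.
(* If the last letter is false, validity makes the preceding exit letter true, which is that of p;
   semiforcing up to [k] is enough. *)
have semi m : m = cost F1 B1 k ->
    exists F B, [/\ allowed p F B k.+1, semiforced p F B k.+1 & cost F B k.+1 = m].
  move=> ->; apply: (ext F1 B1 false false (fun F B => semiforced p F B k.+1)); rewrite ?addn0 //.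
  move=> F' B' f' _ sr p' r e; have /rivalS[/sr r' + _ _] := r.
  rewrite e p1 orbF => o' i ik; apply: (last i _ _ _ r) => //.
  by apply: g1 => //; apply/eqP; rewrite -outE q o'.
have full m : t k.+1 <> Tight -> m = a.+1 - d ->
    exists F B, [/\ allowed p F B k.+1, forced p F B k.+1 & cost F B k.+1 = m].
  move=> nt ->; apply: (ext F1 B1 true false (fun F B => forced p F B k.+1)) => //; try lia.
    by move=> _ [/nt].
  move=> F' B' f' _ sr p' r; have /rivalS[/sr r' + /(_ f') e _] := r.
  rewrite e p1 orbF => o' i ik; apply: (last i _ _ _ r) => //.
  by apply: g1 => //; apply/eqP; rewrite -outE q o'.
case tk: (t k.+1) full => full /=.
- by split; [apply: full|apply: (sub (a.+1 - d, 1) (cost F1 B1 k)); [apply: semi|rewrite /=; lia]].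
- by split; [apply: full|apply: (sub (a.+1 - d, 1) (cost F1 B1 k)); [apply: semi|rewrite /=; lia]].
split; last by apply: (sub (a.+1, d.+1) (cost F1 B1 k)); [apply: semi|rewrite /=; lia].
(* The preceding word is forced and its exit letter is true, so excluding the chord leaves only
   false for the last letter. *)
apply: (ext F0 B0 false true (fun F B => forced p F B k.+1)) => //; last by rewrite c0 addn1.
  by rewrite p1 andbF.
move=> F' B' _ b' sr p' r; have /rivalS[/sr r' _ _ /(_ b') o'] := r.
have H := g0 p' r' => i ik; apply: (last i _ _ _ r) => //.
by move: o'; rewrite (H k) // q p1 /=; case: (p' _).
Qed.

End Chain.

(** * Interval calculus for the attained costs *)

(* The values of a reached with (exit letter, d) = (true, 0), (true, 1),
   (false, 0 or 1), (false, 2) form the intervals A, B, D, E, the upper ends of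
   E and B being equal whenever E is not empty.  The ends stored for an empty
   interval are harmless in all the minima and maxima below; which intervals
   A, D, E are not empty is recorded by the flags. *)
Record ends := Ends { loA : nat; hiA : nat; loB : nat; hiB : nat;
                      loD : nat; hiD : nat; loE : nat }.

Definition ends0 : ends := Ends 1 0 1 1 1 1 2.

Definition next_ends (t : face_type) (e : ends) : ends :=
  let: Ends lA hA lB hB lD hD lE := e in
  match t with
  | Mono => let b := minn lA.+1 lB in
      Ends b 0 b (maxn hA.+1 hB) (minn lD (minn lE (minn lA.+1 lB.+1))) hB.+1 b.+1
  | Turn => let b := minn lE (minn lA.+1 lB.+1) in
      Ends lD hD b hB.+1 (minn lA.+1 lB) (maxn hA.+1 hB) b.+1
  | Tight => let b := minn lE (minn lA.+1 lB.+1) in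
      Ends lD hD b hB.+1 lA.+1 hA.+1 lB.+1
  end.

Definition next_flags (t : face_type) (f : bool * bool * bool) :=
  let: (fA, fD, fE) := f in
  match t with
  | Mono => (false, true, false)
  | Turn => (fD, true, false)
  | Tight => (fD, fA, true)
  end.

(* Difference bounds, found by computer search, that are inductive and make
   adjacent the intervals of which [next_ends] takes the union. *)
Definition ends_inv (f : bool * bool * bool) (e : ends) : bool :=
  let: Ends lA hA lB hB lD hD lE := e in
  match f with
  | (false, true, false) =>
    [&& 0 < lA, 0 < lB, 0 < lD, lA <= hB, lA <= lD + 1, lA <= hD,
        hA + 1 <= lD, lB + 1 <= lE, lD <= lB, hD <= hB + 1 & lE <= lA + 1]
  | (true, true, false) =>
    [&& 0 < lA, 0 < lB, 0 < lD, lA <= hA, lA <= lD, hA <= hB, lB <= hA + 1,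
        lB + 1 <= lE, hB <= hD + 1, lD <= lA + 1, lD + 1 <= hB,
        lD + 1 <= lE, hD <= hB, lE <= lB + 1 & lE <= lD + 2]
  | (true, false, true) =>
    [&& 0 < lA, 0 < lB, 0 < lD, lA + 1 <= lB, lA + 1 <= hB, lA + 1 <= lD,
        hA <= hB, lB <= hA + 1, lB <= lE, lD <= lA + 2, lD <= hA + 1 & hD <= lA]
  | (true, true, true) =>
    [&& 0 < lA, 0 < lB, 0 < lD, lA <= hA, lA <= lB, lA + 1 <= lE,
        hA + 1 <= hB, lB <= lA + 1, lB <= lD, lD <= lB, lD <= hD & hD <= hB]
  | (false, true, true) =>
    [&& 0 < lA, 0 < lB, 0 < lD, lA <= lD + 1, lA <= hD, hA + 1 <= lD,
        lB <= lA, lB + 1 <= lE, lD <= lB & hD <= hB]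
  | _ => false
  end.

Lemma ends_inv_next t f e : ends_inv f e -> ends_inv (next_flags t f) (next_ends t e).
Proof.
case: f e => [[fA fD] fE] [lA hA lB hB lD hD lE].
by case: t; case: fA; case: fD; case: fE; rewrite /ends_inv /=; lia.
Qed.

Definition in_class (f : bool * bool * bool) (e : ends) (q : bool) (d a : nat) : bool :=
  let: (fA, fD, fE) := f in
  let: Ends lA hA lB hB lD hD lE := e in
  match q, d with
  | true, 0 => fA && (lA <= a <= hA)
  | true, 1 => lB <= a <= hB
  | false, 0 => fD && (lD <= a <= hD)
  | false, 2 => fE && (lE <= a <= hB)
  | _, _ => false
  end.

(** After an exit letter false the next step uses only [d.-1], so d = 0 and d = 1 have the same
    future. *)
Definition class (q : bool) (d : nat) := if q then d else if d is 1 then 0 else d.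
Definition attained t k q d a :=
  exists p, [/\ valid t p k, exit_bit (t k) (p k) = q & dp t p k = (a, d)].

Lemma attainedS t k q d a : attained t k.+1 q d a <-> exists q0 d0 a0 b,
  [/\ attained t k q0 d0 a0, q0 || b, q = exit_bit (t k.+1) b
    & (a, d) = dp_step (t k.+1) q0 b (a0, d0)].
Proof.
split=> [[p [/validS[v o] <- /= <-]]|[q0 [d0 [a0 [b [[p [v <- ep]] o -> e]]]]]].
  exists (exit_bit (t k) (p k)), (dp t p k).2, (dp t p k).1, (p k.+1).
  by split=> //; [exists p; split=> //; case: (dp t p k)|case: (dp t p k)].
have eqp i : i <= k -> p i = upd p k.+1 b i by move=> ik; rewrite upd_lt.
exists (upd p k.+1 b); rewrite /= !upd_eq; split=> //.
  by apply/validS; rewrite upd_eq upd_lt //; split=> //; apply: eq_valid v.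
by rewrite e upd_lt // -(eq_dp _ eqp) ep.
Qed.
(** The image of the set [P] of states under [dp_step], written backwards: which earlier states lead
    to the value a. *)
Definition next_class (t : face_type) (P : bool -> nat -> nat -> bool)
    (q : bool) (c a : nat) : bool :=
  match t, q, c with
  | Mono, true, 1 => (0 < a) && P true 0 a.-1 || P true 1 a
  | Mono, false, 0 =>
      [|| P false 0 a, P false 2 a | (0 < a) && (P true 0 a.-1 || P true 1 a.-1)]
  | (Turn | Tight), true, 0 => P false 0 a
  | (Turn | Tight), true, 1 =>
      P false 2 a || (0 < a) && (P true 0 a.-1 || P true 1 a.-1)
  | Turn, false, 0 => (0 < a) && P true 0 a.-1 || P true 1 a
  | Tight, false, 0 => (0 < a) && P true 0 a.-1
  | Tight, false, 2 => (0 < a) && P true 1 a.-1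
  | _, _, _ => false
  end.

(** Here gaps are excluded: the inequalities of [ends_inv] make the merged intervals overlap or
    touch, so that their minima and maxima describe the union. *)
Lemma in_class_next t f e q c a : ends_inv f e ->
  in_class (next_flags t f) (next_ends t e) q c a = next_class t (in_class f e) q c a.
Proof.
case: f e => [[fA fD] fE] [lA hA lB hB lD hD lE].
case: c => [|[|[|c]]]; case: q; case: t; case: fA; case: fD; case: fE;
  rewrite /ends_inv /in_class /next_class /=; lia.
Qed.

Fixpoint ends_at t k : ends := if k is j.+1 then next_ends (t k) (ends_at t j) else ends0.

Fixpoint flags_at t k :=
  if k is j.+1 then next_flags (t k) (flags_at t j) else (false, true, false).

Lemma ends_at_inv t k : ends_inv (flags_at t k) (ends_at t k).
Proof. by elim: k => //= k; apply: ends_inv_next. Qed.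

(** A first face [Turn] starts the scan with both exit letters and (a, d) = (1, 1): the intervals B
    and D of [ends0] are {1}, and A and E are empty. *)
Lemma in_classP t k q c a : t 0 = Turn ->
  in_class (flags_at t k) (ends_at t k) q c a <->
  exists2 d, class q d = c & attained t k q d a.
Proof.
move=> t0; elim: k q c a => [|k IH] q c a.
  split.
    case: q c => [] [|[|[|c]]] //=.
      by move=> H; exists 1 => //; exists xpredT; rewrite /= t0; split=> //; congr pair; lia.
    by move=> H; exists 1 => //; exists xpred0; rewrite /= t0; split=> //; congr pair; lia.
  by case=> d <- [p [_ ]]; rewrite t0 /= => <- [<- <-]; case: (p 0).
rewrite /= in_class_next ?ends_at_inv //.
set P := in_class _ _ in IH *.
split.
  have mk q0 d0 a0 b d : attained t k q0 d0 a0 -> q0 || b -> q = exit_bit (t k.+1) b ->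
      (a, d) = dp_step (t k.+1) q0 b (a0, d0) -> class q d = c ->
      exists2 d, class q d = c & attained t k.+1 q d a.
    by move=> r o e1 e2 ec; exists d => //; apply/attainedS; exists q0, d0, a0, b.
  have A n : P true 0 n -> attained t k true 0 n by case/IH=> d /= ->.
  have B n : P true 1 n -> attained t k true 1 n by case/IH=> d /= ->.
  have D n : P false 0 n -> attained t k false 0 n \/ attained t k false 1 n.
    by case/IH=> [[|[|d]]] //= _ r; [left | right].
  have E n : P false 2 n -> attained t k false 2 n by case/IH=> [[|[|[|d]]]].
  case: a mk => [|a] mk; case tk: (t k.+1) mk => mk; case: q c mk => [] [|[|[|c]]] //= mk;
    rewrite ?andbF ?orbF //=.
  all: repeat (first [ case/orP | case/D=> r | move/A=> r | move/B=> r | move/E=> r ]).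
  all: try (by apply: (mk _ _ _ true _ r)).
  all: try (by apply: (mk _ _ _ false _ r)).
case=> d ec /attainedS[q0 [d0 [a0 [b [r o eq e]]]]].
have {r} : P q0 (class q0 d0) a0 by apply/IH; exists d0.
have P2 m n : P true m.+2 n = false.
  by rewrite /P /in_class; case: (flags_at t k) => [[]] //; case: (ends_at t k).
have P3 m n : P false m.+3 n = false.
  by rewrite /P /in_class; case: (flags_at t k) => [[]] //; case: (ends_at t k).
case: q0 o e => o e; case: d0 e => [|[|[|d0]]] e /=; rewrite ?P2 ?P3 //= => r.
all: move: o e ec eq; case: b; case: (t k.+1) => //= _ [-> ->] <- -> /=.
all: by rewrite ?subn0 ?subn1 /= ?r ?orbT.
Qed.
Definition lowest (e : ends) : nat := minn (loA e) (minn (loB e) (loD e)).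
Definition highest (e : ends) : nat := maxn (hiB e) (hiD e).

Lemma in_class_range f e a : ends_inv f e -> f.1.2 -> ~~ f.2 ->
  (lowest e <= a <= highest e) =
  [|| in_class f e true 0 a, in_class f e true 1 a | in_class f e false 0 a].
Proof.
case: f e => [[fA fD] fE] [lA hA lB hB lD hD lE] I /= fD1 /negbTE fE0; move: I; rewrite fD1 fE0.
by rewrite /lowest /highest /=; case: fA; rewrite /ends_inv /=; lia.
Qed.
Lemma spectrum_range t k a : t 0 = Turn -> t k = Turn ->
  (exists2 p, valid t p k & (dp t p k).1 = a) <->
  lowest (ends_at t k) <= a <= highest (ends_at t k).
Proof.
move=> t0 tk.
have [fD fE] : (flags_at t k).1.2 /\ (flags_at t k).2 = false.
  by case: k tk => [|k] /= tk; rewrite ?tk //; case: (flags_at t k) => [[]].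
rewrite (in_class_range _ (ends_at_inv t k)) ?fE //.
split=> [[p v <-]|]; last first.
  have R q c : in_class (flags_at t k) (ends_at t k) q c a ->
      exists2 p, valid t p k & (dp t p k).1 = a.
    by move/(@in_classP t k q c a t0)=> [d _ [p [v _ e]]]; exists p; rewrite ?e.
  by case/or3P; apply: R.
have : exists q d, in_class (flags_at t k) (ends_at t k) q (class q d) (dp t p k).1.
  exists (exit_bit (t k) (p k)), (dp t p k).2; apply/(@in_classP t k) => //.
  by exists (dp t p k).2 => //; exists p; split=> //; case: (dp _ _ _).
move: fE; case: (flags_at t k) => [[fA ?] fE] /= ->; case: (ends_at t k) => ? ? ? ? ? ? ?.
by case=> [[] [[|[|[|?]]]]] //= ->; rewrite ?orbT.
Qed.

(** The chain being shorter than the number of darts, this bounds both the words of the machine and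
    the length of the output. *)
Lemma ends_at_le t k : let e := ends_at t k in
  [/\ loA e <= k.+2, loB e <= k.+2, loD e <= k.+2 & loE e <= k.+2] /\
  [/\ hiA e <= k.+2, hiB e <= k.+2 & hiD e <= k.+2].
Proof.
elim: k => [//|k /=]; case: (ends_at t k) => lA hA lB hB lD hD lE /= [[]].
by move=> ? ? ? ? [? ? ?]; case: (t k.+1) => /=; split; split; lia.
Qed.

Lemma lowest_gt0 t k : 0 < lowest (ends_at t k).
Proof.
have := ends_at_inv t k; move: (flags_at t k) => [[[] []] []];
by case: (ends_at t k) => ? ? ? ? ? ? ?; rewrite /lowest /ends_inv /=; lia.
Qed.

(** * Homology over F_2 *)

Section Homology.
Variable G : plane_graph.
Local Notation V := (vert G).
Implicit Types (d : V * V) (v w : V).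

Definition twin d : V * V := (d.2, d.1).
Definition dnext d := dart_next (@Defs.rot G) d.
Definition turn d : V * V := (d.1, Defs.rot d.1 d.2).
Definition face d := dart_face (@Defs.rot G) d.
Definition dart d := adj d.1 d.2.
Definition edge d : {set V} := [set d.1; d.2].

Lemma twinK : involutive twin.
Proof. by case. Qed.

Lemma edge_twin d : edge (twin d) = edge d.
Proof. by rewrite /edge setUC. Qed.

Lemma dart_twin d : dart (twin d) = dart d.
Proof. by rewrite /dart adj_sym. Qed.

Lemma dart_neq d : dart d -> d.1 != d.2.
Proof. by rewrite /dart; case: eqP => // ->; rewrite adj_irrefl. Qed.

Lemma twin_neq d : dart d -> twin d != d.
Proof. by case: d => u w /dart_neq /=; apply: contra => /eqP[-> _]. Qed.

Lemma dnext_twin d : dnext (twin d) = turn d.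
Proof. by []. Qed.

Lemma dnext_inj : injective dnext.
Proof.
by move=> [u v] [u' v'] [/= <-] /perm_inj->.
Qed.

Lemma faceP d d' : reflect (face d = face d') (d' \in face d).
Proof.
rewrite /face /dart_face inE; apply: (iffP idP) => [c|e].
  by apply/setP=> x; rewrite !inE; exact: (same_connect (fconnect_sym dnext_inj) c).
by have := connect0 (frel dnext) d'; move/setP/(_ d'): e; rewrite !inE => ->.
Qed.

Lemma mem_face d : d \in face d.
Proof. exact/faceP. Qed.

Lemma face_next d : face (dnext d) = face d.
Proof. by apply/esym/faceP; rewrite inE fconnect1. Qed.

Lemma face_turn d : face (turn d) = face (twin d).
Proof. by rewrite -dnext_twin face_next. Qed.

Lemma dart_turn d : dart (turn d) = dart d.
Proof.
case: d => u v; rewrite /dart /turn /=.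
apply/idP/idP => [a|a].
  have := rotP a; move/setP/(_ v); rewrite inE => <-.
  by rewrite porbit_sym; have := mem_porbit (Defs.rot u) 1 v; rewrite expg1.
have := rotP a; move/setP/(_ (Defs.rot u v)); rewrite inE => <-.
by have := mem_porbit (Defs.rot u) 1 v; rewrite expg1.
Qed.

Lemma dart_dnext d : dart (dnext d) = dart d.
Proof. by rewrite -{1}[d]twinK dnext_twin dart_turn dart_twin. Qed.

Lemma dart_face_mem d d' : d' \in face d -> dart d' = dart d.
Proof.
rewrite inE => /iter_findex <-; elim: (findex _ _ _) => //= n IH.
by rewrite -[Defs.dart_next _ _]/(dnext _) dart_dnext.
Qed.

Lemma edges_dart d : dart d -> edge d \in edges G.
Proof. by move=> a; apply/imsetP; exists d; rewrite ?inE. Qed.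

Lemma edgesP e : reflect (exists2 d, dart d & e = edge d) (e \in edges G).
Proof.
by apply: (iffP imsetP) => -[d]; [rewrite inE|] => a ->; exists d; rewrite ?inE.
Qed.

Lemma facesP f : reflect (exists2 d, dart d & f = face d) (f \in faces G).
Proof.
by apply: (iffP imsetP) => -[d]; [rewrite inE|] => a ->; exists d; rewrite ?inE.
Qed.

Lemma edge_inj d d' : edge d = edge d' -> d' = d \/ d' = twin d.
Proof.
case: d d' => [u v] [u' v'] /setP e; rewrite /twin /=.
have := e v; have := e u; have := e v'; have := e u'.
rewrite !inE /= !eqxx !orbT /= => /orP[]/eqP-> /orP[]/eqP->; rewrite ?orbb ?eqxx ?orbT.
- by move=> _ /esym/eqP->; left.
- by left.
- by right.
by move=> /esym/eqP->; left.
Qed.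

Lemma rotation_transitive v w w' : adj v w -> adj v w' ->
  exists i, w' = iter i (Defs.rot v) w.
Proof.
move=> a a'; have : w' \in porbit (Defs.rot v) w by rewrite (rotP a) inE.
by case/porbitP=> i ->; exists i; rewrite permX.
Qed.

Lemma connect_vertices v w : connect (@adj G) v w.
Proof.
have /forallP/(_ v) := plane_connected G; rewrite inE /= => /forallP/(_ w).
rewrite inE /=; apply: connect_sub => x y /= a; apply: connect1.
by case/and3P: a.
Qed.

Lemma connected_ind (T : eqType) (g : V -> T) :
  (forall d, dart d -> g d.1 = g d.2) -> forall v w, g v = g w.
Proof.
move=> gE v w; have /connectP[p + ->] := connect_vertices v w.
elim: p v => //= x p IH v /andP[a /IH <-]; exact: (gE (v, x)).
Qed.

(** Connectedness in the form that also serves the dual: [twin] and [turn] together reach every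
    dart. *)
Lemma dart_ind (T : eqType) (g : V * V -> T) :
  (forall d, dart d -> g (twin d) = g d) -> (forall d, dart d -> g (turn d) = g d) ->
  forall d d', dart d -> dart d' -> g d = g d'.
Proof.
move=> gt gr.
have same v w w' : adj v w -> adj v w' -> g (v, w) = g (v, w').
  move=> a a'; have [i ->] := rotation_transitive a a'; elim: i => //= i ->.
  have ai : dart (v, iter i (Defs.rot v) w).
    by elim: i => //= i; rewrite -(dart_turn (v, _)).
  by rewrite -(gr (v, _)).
move=> [v w] [v' w'] a a'; have /connectP[p + E] := connect_vertices v v'.
elim: p v w a E => [|x p IH] v w a /= E.
  by rewrite E in a' *; move=> _; apply: same.
case/andP=> vx px; rewrite (same _ _ _ a vx) -(gt (v, x)) //; apply: IH => //=.
by rewrite /dart /= adj_sym.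
Qed.

Local Open Scope ring_scope.
Import GRing.Theory.
Local Notation K := 'F_2.

Lemma F2_add (x : K) : x + x = 0.
Proof. by rewrite -mulr2n -mulr_natl (_ : 2%:R = 0 :> K) ?mul0r //; apply/eqP. Qed.

Lemma F2_eq (x y : K) : x + y = 0 -> x = y.
Proof. by move=> e; rewrite -[x]addr0 -(F2_add y) addrA e add0r. Qed.

Lemma F2_bool (x : K) : x = (x != 0)%:R.
Proof. by case: x => [[|[|n]] i] //; apply/eqP. Qed.

Lemma F2_addb (b c : bool) : (b (+) c)%:R = b%:R + c%:R :> K.
Proof. by case: b; case: c; rewrite ?addr0 ?add0r ?F2_add. Qed.

Lemma F2_inj (b c : bool) : b%:R = c%:R :> K -> b = c.
Proof. by case: b; case: c => // /eqP. Qed.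

Lemma F2_nat n : n%:R = (odd n)%:R :> K.
Proof. by elim: n => //= n IH; rewrite mulrS IH (F2_addb true). Qed.

Definition vertex_edge : 'M[K]_(nv G, #|edges G|) :=
  \matrix_(v, j) (v \in (enum_val j : {set V}))%:R.

(** An edge with the same face on both sides is counted twice, that is not at all. *)
Definition face_edge : 'M[K]_(#|faces G|, #|edges G|) :=
  \matrix_(i, j) \sum_(d | dart d && (face d == enum_val i)) (edge d == enum_val j)%:R.

Lemma sum_edge (g : {set V} -> K) d : dart d ->
  \sum_(j < #|edges G|) g (enum_val j) * (edge d == enum_val j)%:R = g (edge d).
Proof.
move=> a; rewrite -(big_enum_val (fun e => g e * (edge d == e)%:R)) /=.
rewrite (bigD1 (edge d)) ?edges_dart //= eqxx mulr1 big1 ?addr0 // => e /andP[_].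
by rewrite eq_sym => /negbTE->; rewrite mulr0.
Qed.

Lemma mul_vertex_edge (x : 'rV[K]_(nv G)) (j : 'I_#|edges G|) d :
  dart d -> enum_val j = edge d -> (x *m vertex_edge) 0 j = x 0 d.1 + x 0 d.2.
Proof.
move=> a ej; rewrite mxE (bigD1 d.1) //= (bigD1 d.2) /=; last by rewrite eq_sym dart_neq.
rewrite !mxE ej !inE !eqxx orbT !mulr1 addrA big1 ?addr0 // => v /andP[v1 v2].
by rewrite !mxE ej !inE (negbTE v1) (negbTE v2) mulr0.
Qed.

Definition face_value (y : 'rV[K]_#|faces G|) (f : {set V * V}) : K :=
  \sum_(i | enum_val i == f) y 0 i.

Lemma face_value_enum y i : face_value y (enum_val i) = y 0 i.
Proof.
rewrite /face_value (big_pred1 i) // => k.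
by rewrite (inj_eq enum_val_inj).
Qed.

Lemma mul_face_edge (y : 'rV[K]_#|faces G|) (j : 'I_#|edges G|) d :
  dart d -> enum_val j = edge d ->
  (y *m face_edge) 0 j = face_value y (face d) + face_value y (face (twin d)).
Proof.
move=> a ej; rewrite mxE.
transitivity (\sum_(d' | dart d') face_value y (face d') * (edge d' == edge d)%:R).
  under eq_bigr => i _ do rewrite mxE mulr_sumr ej.
  rewrite (exchange_big_dep dart) /=; last by move=> ? ? _ /andP[].
  apply: eq_bigr => d' a'; rewrite /face_value mulr_suml.
  by apply: eq_bigl => i; rewrite a' eq_sym.
rewrite (bigD1 d) //= (bigD1 (twin d)) /=; last by rewrite dart_twin a twin_neq.
rewrite edge_twin eqxx !mulr1 addrA big1 ?addr0 // => d' /andP[/andP[_ n1] n2].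
case: eqP => [/esym/edge_inj[] e|_]; rewrite ?mulr0 //.
  by rewrite e eqxx in n1.
by rewrite e eqxx in n2.
Qed.

(** Along a face the end of each dart is the origin of the next, so re-indexing one of the two sums
    by [dnext] makes them equal, and they cancel in characteristic 2. *)
Lemma vertex_face_edge : vertex_edge *m face_edge^T = 0.
Proof.
apply/matrixP=> v i; rewrite !mxE.
transitivity (\sum_(d | dart d && (face d == enum_val i)) (v \in edge d)%:R : K).
  under eq_bigr => j _ do rewrite !mxE mulr_sumr.
  rewrite exchange_big /=; apply: eq_bigr => d /andP[a _].
  exact: (sum_edge (fun e => (v \in e)%:R)).
transitivity (\sum_(d | dart d && (face d == enum_val i)) ((v == d.1)%:R + (v == d.2)%:R) : K).
  apply: eq_bigr => d /andP[a _]; rewrite -F2_addb !inE.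
  by case: (eqVneq v d.1) => [->|//]; rewrite (negbTE (dart_neq a)).
rewrite big_split /= [X in X + _](reindex_inj dnext_inj) /=.
under eq_bigl => d do rewrite dart_dnext face_next.
exact: F2_add.
Qed.

Lemma rank_vertex_edge : (nv G <= (\rank vertex_edge).+1)%N.
Proof.
have : (\rank (kermx vertex_edge) <= 1)%N.
  apply: leq_trans (rank_leq_row (const_mx 1 : 'rV[K]_(nv G))).
  apply: mxrankS; apply/row_subP => i; set u := row i _.
  have ku : u *m vertex_edge = 0 by apply/sub_kermxP; apply: row_sub.
  have cu : forall v w, u 0 v = u 0 w.
    apply: connected_ind => d a; apply: F2_eq.
    rewrite -(@mul_vertex_edge u (enum_rank_in (edges_dart a) (edge d))) ?enum_rankK_in ?edges_dart //.
    by rewrite ku mxE.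
  have -> : u = u 0 (outer_dart G).1 *: const_mx 1.
    by apply/rowP=> k; have := cu k (outer_dart G).1; rewrite !mxE mulr1.
  by apply: scalemx_sub.
by rewrite mxrank_ker; lia.
Qed.

(** The dual of [rank_vertex_edge]: a function on faces with zero boundary agrees on the two sides
    of every edge, hence is constant. *)
Lemma rank_face_edge : (#|faces G| <= (\rank face_edge).+1)%N.
Proof.
have : (\rank (kermx face_edge) <= 1)%N.
  apply: leq_trans (rank_leq_row (const_mx 1 : 'rV[K]_#|faces G|)).
  apply: mxrankS; apply/row_subP => i; set y := row i _.
  have ky : y *m face_edge = 0 by apply/sub_kermxP; apply: row_sub.
  have tw d : dart d -> face_value y (face (twin d)) = face_value y (face d).
    move=> a; apply/esym/F2_eq.
    rewrite -(@mul_face_edge y (enum_rank_in (edges_dart a) (edge d))) ?enum_rankK_in ?edges_dart //.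
    by rewrite ky mxE.
  have c d d' : dart d -> dart d' -> face_value y (face d) = face_value y (face d').
    apply: (dart_ind (g := fun d => face_value y (face d))) => // x ax.
    by rewrite face_turn tw.
  have -> : y = face_value y (face (outer_dart G)) *: const_mx 1.
    apply/rowP=> k; have /facesP[d a e] := enum_valP k.
    rewrite -face_value_enum e (c _ (outer_dart G) a (outer_dartP G)).
    by move: (face_value _ _) => z; rewrite !mxE mulr1.
  by apply: scalemx_sub.
by rewrite mxrank_ker; lia.
Qed.

(** The zero product bounds the sum above by the number of edges; the two rank bounds and Euler's
    formula give the same number below. *)
Lemma rank_sum : (\rank vertex_edge + \rank face_edge = #|edges G|)%N.
Proof.
have := mulmx0_rank_max vertex_face_edge; rewrite mxrank_tr.
have := rank_vertex_edge; have := rank_face_edge; have := euler_formula G.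
by rewrite -/(faces G); lia.
Qed.


Definition edge_row (A : V * V -> bool) : 'rV[K]_#|edges G| :=
  \row_j [exists d, [&& dart d, edge d == enum_val j & A d]]%:R.

Lemma edge_rowE A (j : 'I_#|edges G|) d : (forall d, dart d -> A (twin d) = A d) ->
  dart d -> enum_val j = edge d -> edge_row A 0 j = (A d)%:R.
Proof.
move=> At a ej; rewrite mxE ej; congr (nat_of_bool _)%:R.
apply/existsP/idP => [[d' /and3P[a' /eqP/esym/edge_inj[]->]]|Ad]; rewrite ?At //.
by exists d; rewrite a eqxx.
Qed.

Lemma edge_row_sum (A : V * V -> bool) d : (forall d, dart d -> A (twin d) = A d) -> dart d ->
  (A d)%:R = \sum_(j < #|edges G|) edge_row A 0 j * (edge d == enum_val j)%:R.
Proof.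
move=> At a; have e := enum_rankK_in (edges_dart a) (edges_dart a).
rewrite -(edge_rowE At a e) mxE e.
rewrite -(sum_edge (fun e => [exists d0, [&& dart d0, edge d0 == e & A d0]]%:R) a).
by apply: eq_bigr => j _; rewrite mxE.
Qed.

(** Exactness at the edges: [rank_sum] turns the inclusion of the cuts in the edge sets that are
    even on every face into an equality. X tells the side of the cut. *)
Lemma cohomology (A : V * V -> bool) :
    (forall d, dart d -> A (twin d) = A d) ->
    (forall d, dart d -> ~~ odd (\sum_(x in face d) A x)) ->
  exists X : V -> bool, forall d, dart d -> A d = X d.1 (+) X d.2.
Proof.
move=> At Af; have sub : (vertex_edge <= kermx face_edge^T)%MS.
  exact/sub_kermxP/vertex_face_edge.
have eqr : \rank vertex_edge = \rank (kermx face_edge^T).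
  by have := rank_sum; rewrite mxrank_ker mxrank_tr; lia.
have /mxrank_leqif_eq/leqifP := sub; rewrite eqr ltnn; case: ifP => // eqm _.
have : (edge_row A <= vertex_edge)%MS.
  rewrite (eqmxP eqm); apply/sub_kermxP/rowP => i; rewrite [LHS]mxE [RHS]mxE.
  have /facesP[d a ei] := enum_valP i.
  transitivity (\sum_(x | dart x && (face x == face d)) (A x)%:R : K).
    rewrite (eq_bigr (fun j => \sum_(x | dart x && (face x == face d))
        edge_row A 0 j * (edge x == enum_val j)%:R)) => [|j _]; last first.
      by rewrite [face_edge^T _ _]mxE [face_edge _ _]mxE mulr_sumr ei.
    rewrite exchange_big /=; apply: eq_bigr => x /andP[ax _].
    by rewrite (edge_row_sum At ax).
  rewrite -natr_sum.
  rewrite (eq_bigl (mem (face d))) => [|x] /=; last first.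
    by apply/andP/faceP => [[_ /eqP]//|/faceP/[dup]/dart_face_mem-> /faceP->].
  by rewrite F2_nat (negbTE (Af _ a)).
case/submxP=> x Ax; exists (fun v => x 0 v != 0) => d a.
apply: F2_inj; rewrite F2_addb -!F2_bool.
have e := enum_rankK_in (edges_dart a) (edges_dart a).
by rewrite -(mul_vertex_edge x a e) -Ax -(edge_rowE At a e).
Qed.

(** The transposed argument: edge sets even at every vertex are sums of face boundaries. *)
Lemma homology (B : V * V -> bool) :
    (forall d, dart d -> B (twin d) = B d) ->
    (forall v, ~~ odd (\sum_(w | adj v w) B (v, w))) ->
  exists Y : {set V * V} -> bool,
    forall d, dart d -> B d = Y (face d) (+) Y (face (twin d)).
Proof.
move=> Bt Bv; have sub : (face_edge <= kermx vertex_edge^T)%MS.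
  by apply/sub_kermxP; rewrite -[LHS]trmxK trmx_mul trmxK vertex_face_edge trmx0.
have eqr : \rank face_edge = \rank (kermx vertex_edge^T).
  by have := rank_sum; rewrite mxrank_ker mxrank_tr; lia.
have /mxrank_leqif_eq/leqifP := sub; rewrite eqr ltnn; case: ifP => // eqm _.
have : (edge_row B <= face_edge)%MS.
  rewrite (eqmxP eqm); apply/sub_kermxP/rowP => v; rewrite [LHS]mxE [RHS]mxE.
  transitivity (\sum_(w | adj v w) (B (v, w))%:R : K).
    symmetry; rewrite (eq_bigr (fun w => \sum_j
        edge_row B 0 j * (edge (v, w) == enum_val j)%:R)) => [|w vw]; last exact: edge_row_sum.
    rewrite exchange_big /=; apply: eq_bigr => j _; rewrite -mulr_sumr; congr (_ * _).
    rewrite [vertex_edge^T _ _]mxE [vertex_edge _ _]mxE.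
    case vj: (v \in (enum_val j : {set V})); last first.
      rewrite big1 // => w _; case: eqP => // ej.
      by rewrite -ej !inE eqxx in vj.
    have [w vw ->] : exists2 w, adj v w & enum_val j = edge (v, w).
      have /edgesP[[x y] a ej] := enum_valP j; move: vj; rewrite ej !inE /=.
      case/orP=> /eqP->; first by exists y.
      by exists x; [rewrite adj_sym | exact/esym/(edge_twin (x, y))].
    rewrite (bigD1 w) //= eqxx big1 ?addr0 // => w' /andP[vw' ne].
    case: eqP => // /edge_inj[[e]|[e e']]; first by rewrite e eqxx in ne.
    by move: vw; rewrite e' adj_irrefl.
  by rewrite -natr_sum F2_nat (negbTE (Bv v)).
case/submxP=> y By; exists (fun f => face_value y f != 0) => d a.
apply: F2_inj; rewrite F2_addb -!F2_bool.
have e := enum_rankK_in (edges_dart a) (edges_dart a).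
by rewrite -(mul_face_edge y a e) -By -(edge_rowE Bt a e).
Qed.

End Homology.

(** * Outerplane graphs *)

Lemma iter_neq (T : finType) (f : T -> T) x k : 0 < k < fingraph.order f x -> iter k f x != x.
Proof.
case/andP=> k0 ko; apply/eqP=> e; have := findex_iter ko.
by rewrite e findex0 => k0'; rewrite -k0' in k0.
Qed.

Section Outerplane.
Variable G : plane_graph.
Local Notation V := (vert G).
Local Notation O := (outer_face G).
Implicit Types (d x : V * V) (v w : V) (s : seq (V * V)).

Definition chord d : bool := [&& dart d, face d != O & face (twin d) != O].

Lemma chord_twin d : chord (twin d) = chord d.
Proof. by rewrite /chord dart_twin twinK andbA andbAC -andbA. Qed.

Definition mult2 s d : bool := odd (count_mem d s + count_mem (twin d) s).

Definition closed_walk s : bool :=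
  if s is d :: s' then
    path (fun x y => face (twin x) == face y) d s' && (face (twin (last d s')) == face d)
  else false.

(** Leaving a face through one dart is being on that face at the next one, so all terms but the two
    outermost cancel. *)
Lemma odd_walk f d s : (exists2 x, dart x & f = face x) ->
  path (fun x y => face (twin x) == face y) d s ->
  odd (count (mem f) (d :: s) + count (fun x => twin x \in f) (d :: s))
    = (d \in f) (+) (twin (last d s) \in f).
Proof.
case=> x0 _ ->; have inE' a b : face a = face b -> (a \in face x0) = (b \in face x0).
  by move=> e; apply/faceP/faceP; rewrite e.
elim: s d => [|y s IH] d /=; first by rewrite !addn0 oddD !oddb.
case/andP=> /eqP/inE' e /IH /=; rewrite e !oddD !oddb.
by do 4 case: (_ \in _); do 2 case: (odd _).
Qed.

(** A closed walk in the dual leaves each face as often as it enters it, which is the evenness that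
    [cohomology] asks for. *)
Lemma closed_walk_cut s : all (@dart G) s -> closed_walk s ->
  exists X : V -> bool, forall d, dart d -> mult2 s d = X d.1 (+) X d.2.
Proof.
case: s => // d s ad /andP[p /eqP cl]; apply: cohomology => [x _|x ax].
  by rewrite /mult2 twinK addnC.
rewrite (big_morph odd oddD erefl).
under eq_bigr => y _ do rewrite oddb /mult2.
rewrite -(big_morph odd oddD erefl) big_split /=.
have cnt (P : pred (V * V)) (h : V * V -> V * V) : involutive h ->
    \sum_(y in P) count_mem (h y) (d :: s) = count (fun y => h y \in P) (d :: s).
  move=> hK; elim: (d :: s) => [|y r IH] /=; first by rewrite big1.
  rewrite big_split /= IH; congr addn.
  rewrite big_mkcond /= (bigD1 (h y)) //= hK eqxx big1 ?addn0.
    by case: ifP.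
  by move=> z; rewrite eq_sym -(inj_eq (inv_inj hK)) hK => /negbTE->; case: ifP.
rewrite (cnt _ id (fun _ => erefl)) (cnt _ (@twin G) (@twinK G)).
rewrite (odd_walk _ p); last by exists x.
suff -> : (d \in face x) = (twin (last d s) \in face x) by rewrite addbb.
by apply/faceP/faceP; rewrite cl.
Qed.

Lemma iter_turn1 d m : (iter m (@turn G) d).1 = d.1.
Proof. by elim: m. Qed.

Lemma dart_iter_turn d m : dart (iter m (@turn G) d) = dart d.
Proof. by elim: m => //= m <-; rewrite dart_turn. Qed.

Lemma turn_arc d m : dart d -> 0 < m ->
    (forall k, 0 < k < m -> iter k (@turn G) d != d) ->
    face (iter m (@turn G) d) = face d ->
  let s := traject (@turn G) d m in
  [/\ all (@dart G) s, closed_walk s & mult2 s d].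
Proof.
case: m => // m a _ nd e s; split.
- by apply/allP=> x /trajectP[i _ ->]; rewrite dart_iter_turn.
- rewrite /s trajectS /=; apply/andP; split; last first.
    by rewrite last_traject -face_turn -iterS e.
  elim: m {nd e s} d {a} => //= m IH d; rewrite face_turn eqxx; exact: IH.
have ns x : x \in s -> x.1 = d.1 by case/trajectP=> i _ ->; rewrite iter_turn1.
have /count_memPn c2 : twin d \notin s.
  by apply/negP=> /ns /= e1; have := dart_neq a; rewrite e1 eqxx.
rewrite /mult2 c2 addn0 /s trajectS /= eqxx.
suff /count_memPn-> : d \notin traject (@turn G) (turn d) m by [].
apply/negP=> /trajectP[i im e1].
by have := nd i.+1 im; rewrite iterSr -e1 eqxx.
Qed.

Lemma mult2_notin d m x : dart x -> x.1 = d.1 -> x \notin traject (@turn G) d m ->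
  mult2 (traject (@turn G) d m) x = false.
Proof.
move=> a e /count_memPn; rewrite /mult2 => ->.
suff /count_memPn-> : twin x \notin traject (@turn G) d m by [].
apply/negP=> /trajectP[i _ /(congr1 fst)]; rewrite iter_turn1 /= => e'.
by have := dart_neq a; rewrite e e' eqxx.
Qed.

Lemma mult2_away d m x : x.1 != d.1 -> x.2 != d.1 ->
  mult2 (traject (@turn G) d m) x = false.
Proof.
move=> n1 n2; have out y : y.1 != d.1 -> count_mem y (traject (@turn G) d m) = 0.
  by move=> ny; apply/count_memPn/negP=> /trajectP[i _ e]; rewrite e iter_turn1 eqxx in ny.
by rewrite /mult2 !out.
Qed.

Lemma turn_connect d d' : dart d -> dart d' -> d.1 = d'.1 -> fconnect (@turn G) d d'.
Proof.
case: d d' => [v w] [v' w'] a a' /= e; case: v' / e a' => a'.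
have [i /= ->] := rotation_transitive a a'.
suff -> : (v, iter i (Defs.rot v) w) = iter i (@turn G) (v, w) by apply: fconnect_iter.
by elim: i => //= i <-.
Qed.

Lemma turn_inj : injective (@turn G).
Proof. by move=> [u v] [u' v'] [/= <-] /perm_inj->. Qed.

Section TwoConnected.
Hypotheses (tc : two_connected G) (op : outerplane G).

Lemma outer_at v : exists w, adj v w && (face (v, w) == O).
Proof.
have [e /imsetP[d dO ->]] := op v.
have eO x : x \in O -> face x = O by move=> /faceP<-.
have ax x : x \in O -> dart x by move=> /dart_face_mem->; apply: outer_dartP.
have nO : dnext d \in O by apply/faceP; rewrite face_next (eO _ dO).
rewrite !inE => /orP[]/eqP->.
  by exists d.2; rewrite -surjective_pairing eO // eqxx andbT; apply: ax.
exists (dnext d).2; rewrite -[d.2]/((dnext d).1) -surjective_pairing eO // eqxx andbT.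
exact: ax nO.
Qed.

(** The origin from which the rotation at v is read; by [outer_unique] there is no other outer dart
    at v. *)
Definition outd v : V * V := (v, xchoose (outer_at v)).

Lemma outd_dart v : dart (outd v).
Proof. by have /andP[] := xchooseP (outer_at v). Qed.

Lemma outd_face v : face (outd v) = O.
Proof. by have /andP[_ /eqP] := xchooseP (outer_at v). Qed.

(* The arc of the rotation at a vertex between two outer darts would be a cut
   whose edges share that vertex, which would then be a cut vertex. *)
Lemma outer_unique d d' : dart d -> dart d' -> d.1 = d'.1 ->
  face d = O -> face d' = O -> d = d'.
Proof.
move=> a a' e f f'; apply/eqP/negPn/negP => ne.
have c := turn_connect a a' e; set m := findex (@turn G) d d'.
have m0 : 0 < m by rewrite lt0n findex_eq0.
have mo : m < fingraph.order (@turn G) d by apply: findex_max.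
have em : iter m (@turn G) d = d' by apply: iter_findex.
have nd k : 0 < k < m -> iter k (@turn G) d != d.
  by case/andP=> k0 km; apply: iter_neq; rewrite k0 (ltn_trans km).
have [|as_ cs md] := turn_arc a m0 nd; first by rewrite em f f'.
have [X XE] := closed_walk_cut as_ cs.
have Xout (u w : V) : adj u w -> u != d.1 -> w != d.1 -> X u = X w.
  move=> uw uv wv; have := XE (u, w) uw; rewrite mult2_away //=.
  by case: (X u); case: (X w).
have md' : mult2 (traject (@turn G) d m) d' = false.
  apply: mult2_notin => //; apply/negP=> /trajectP[i im]; rewrite -em => ei.
  by have := findex_iter (ltn_trans im mo); rewrite -ei em -/m => mi; rewrite mi ltnn in im.
have ne1 : d.2 != d.1 by rewrite eq_sym dart_neq.
have ne2 : d'.2 != d.1 by rewrite e eq_sym dart_neq.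
have [_ _ /forallP/(_ d.1)/forallP/(_ d.2)] := and3P tc; rewrite !inE ne1 /=.
move=> /forallP/(_ d'.2); rewrite !inE ne2 /= => /connectP[p pp pl].
have eX : X d.2 = X d'.2.
  rewrite pl; elim: p d.2 pp {pl ne1} => //= y p IH x /andP[/and3P[xv yv xy] /IH <-].
  by apply: Xout; rewrite // !inE in xv yv.
have := XE _ a; have := XE _ a'; rewrite md md' -e -eX => <-.
by [].
Qed.

Lemma dart_turn_fix d w : dart d -> turn d = d -> adj d.1 w -> w = d.2.
Proof.
move=> a t aw; have /iter_findex e := turn_connect a (aw : dart (d.1, w)) erefl.
by rewrite -[w]/((d.1, w).2) -e iter_fix.
Qed.

(** Otherwise [outer_unique] would give both ends degree one, and a connected graph with such an
    edge has only two vertices. *)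
Lemma twin_outer d : dart d -> face d = O -> face (twin d) != O.
Proof.
move=> a f; apply/eqP=> f'.
have t1 : turn d = d by apply: outer_unique; rewrite ?dart_turn ?face_turn.
have t2 : turn (twin d) = twin d.
  by apply: outer_unique; rewrite ?dart_turn ?face_turn ?twinK ?dart_twin.
have at2 : dart (twin d) by rewrite dart_twin.
have c v : (v == d.1) || (v == d.2).
  have <- : (d.1 == d.1) || (d.1 == d.2) = (v == d.1) || (v == d.2); last by rewrite eqxx.
  apply: (connected_ind (g := fun v => (v == d.1) || (v == d.2))) => x ax.
  apply/orP/orP=> -[]/eqP e.
  - by right; apply/eqP/dart_turn_fix => //; rewrite -e.
  - by left; apply/eqP/(dart_turn_fix at2 t2); rewrite /= -e.
  - by right; apply/eqP/dart_turn_fix => //; rewrite -e adj_sym.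
  by left; apply/eqP/(dart_turn_fix at2 t2); rewrite /= -e adj_sym.
have [n2 _ _] := and3P tc.
have /subset_leq_card : [set: V] \subset [set d.1; d.2].
  by apply/subsetP=> v _; rewrite !inE c.
by rewrite cardsT card_ord cards2 leqNgt; case: (_ != _) => //; rewrite ?n2 // ltnW.
Qed.

(* A coboundary without outer edges is constant along the outer walk, which
   meets all the vertices. *)
Lemma acyclic s d : all chord s -> closed_walk s -> dart d -> mult2 s d = false.
Proof.
move=> /allP cs cw a; have as_ : all (@dart G) s by apply/allP=> x /cs/and3P[].
have [X XE] := closed_walk_cut as_ cw.
have Xo x : x \in O -> X x.1 = X (outer_dart G).1.
  rewrite inE => /iter_findex <-; elim: (findex _ _ _) => //= n <-.
  set y := iter n _ _; have yO : face y = O by apply/esym/faceP; rewrite inE fconnect_iter.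
  have ay : dart y.
    have /dart_face_mem-> : y \in face (outer_dart G) by apply/faceP.
    exact: outer_dartP.
  have nc z : face z = O \/ face (twin z) = O -> z \notin s.
    by move=> h; apply/negP=> /cs/and3P[_ n1 n2]; case: h => h; [move: n1|move: n2]; rewrite h eqxx.
  have := XE y ay; rewrite /mult2 !(count_memPn (nc _ _)); first by case: (X y.1); case: (X y.2).
    by right; rewrite twinK.
  by left.
rewrite XE // -[d.1]/((outd d.1).1) -[d.2]/((outd d.2).1) !Xo ?addbb //.
  by apply/faceP; rewrite outd_face.
by apply/faceP; rewrite outd_face.
Qed.

Lemma chord_no_loop d : chord d -> face d != face (twin d).
Proof.
move=> c; apply/eqP=> e; have /and3P[a _ _] := c.
have := @acyclic [:: d] d; rewrite /= c /mult2 /= eqxx e eqxx eq_sym (negbTE (twin_neq a)).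
by move=> /(_ isT isT a).
Qed.

(** Crossing one chord and returning by the other would be a closed walk of chords. *)
Lemma chord_simple d d' : chord d -> chord d' -> face d = face d' ->
  face (twin d) = face (twin d') -> d = d'.
Proof.
move=> c c' e e'; apply/eqP/negPn/negP => ne; have /and3P[a _ _] := c.
have h1 : (twin d' == d) = false.
  by apply/negP=> /eqP h; have := chord_no_loop c'; rewrite h e eqxx.
have h2 : (d == twin d) = false by rewrite eq_sym (negbTE (twin_neq a)).
have h3 : (twin d' == twin d) = false.
  by rewrite (inj_eq (inv_inj (@twinK G))) eq_sym (negbTE ne).
have := @acyclic [:: d; twin d'] d; rewrite /= chord_twin c c' twinK e' e !eqxx.
by rewrite /mult2 /= h1 h2 h3 eqxx => /(_ isT isT a).
Qed.

Lemma inner_turn d k : dart d -> face d = O -> 0 < k < fingraph.order (@turn G) d ->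
  face (iter k (@turn G) d) != O.
Proof.
move=> a f ko; apply/negP=> /eqP f'; have /negP[] := iter_neq ko.
by apply/eqP/outer_unique; rewrite ?dart_iter_turn ?iter_turn1.
Qed.

(** For an inner face, the arc of the rotation between the two darts that avoids the outer dart
    consists of chords, which [acyclic] forbids. *)
Lemma face_simple d d' : dart d -> dart d' -> d.1 = d'.1 -> face d = face d' -> d = d'.
Proof.
move=> a a' e f; have [fO|fO] := eqVneq (face d) O.
  by apply: outer_unique; rewrite -?f.
have o_at x : dart x -> x.1 = d.1 ->
    exists2 i, i < fingraph.order (@turn G) (outd d.1) & iter i (@turn G) (outd d.1) = x.
  move=> ax ex; have c := turn_connect (outd_dart d.1) ax (esym ex).
  by exists (findex (@turn G) (outd d.1) x); [apply: findex_max|apply: iter_findex].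
have [i io di] := o_at d a erefl; have [j jo dj] := o_at d' a' (esym e).
suff key x y i' j' : i' < j' -> j' < fingraph.order (@turn G) (outd d.1) ->
    iter i' (@turn G) (outd d.1) = x -> iter j' (@turn G) (outd d.1) = y ->
    face x = face y -> face x != O -> dart x -> False.
  case: (ltngtP i j) => ij; last by rewrite -di -dj ij.
    by case: (key _ _ i j ij jo di dj f fO a).
  by rewrite f in fO; case: (key _ _ j i ij io dj di (esym f) fO a').
move=> {e f fO o_at io jo di dj i j}; move: i' j' => i j ij jo xi yj f fO ax.
set o := outd d.1 in jo xi yj *.
have i0 : 0 < i.
  by rewrite lt0n; apply/negP=> /eqP i0; move: fO; rewrite -xi i0 outd_face eqxx.
have ney k : 0 < k < j - i -> iter k (@turn G) x != x.
  move=> /andP[k0 kj]; rewrite -xi -iterD; apply/eqP => /(congr1 (findex (@turn G) o)).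
  by rewrite !findex_iter; lia.
have ji : iter (j - i) (@turn G) x = y by rewrite -xi -iterD subnK // ltnW.
have [||as_ cw mx] := turn_arc ax _ ney; [by rewrite subn_gt0 | by rewrite ji|].
suff cs : all chord (traject (@turn G) x (j - i)) by rewrite (acyclic cs cw ax) in mx.
have inn k : k <= j - i -> face (iter k (@turn G) x) != O.
  by move=> kj; rewrite -xi -iterD inner_turn ?outd_dart ?outd_face //; lia.
apply/allP=> z /trajectP[k kj ->]; apply/and3P; split.
- by rewrite dart_iter_turn.
- by apply: inn; apply: ltnW.
by rewrite -face_turn; apply: (inn k.+1).
Qed.

End TwoConnected.

End Outerplane.

(** * Inner faces: their cycles and the connectedness of their dual *)

Section InnerFaces.
Variable G : plane_graph.
Local Notation V := (vert G).
Local Notation O := (outer_face G).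
Implicit Types (d x : V * V) (v w : V) (s : seq (V * V)).
Hypotheses (tc : two_connected G) (op : outerplane G).
Variable col : V -> bool.
Hypothesis colP : forall u v, adj u v -> col u != col v.

Lemma face_iter d k : face (iter k (@dnext G) d) = face d.
Proof. by elim: k => //= k IH; rewrite face_next. Qed.

Lemma dart_iter d k : dart (iter k (@dnext G) d) = dart d.
Proof. by elim: k => //= k IH; rewrite dart_dnext. Qed.

Lemma col_dnext d : dart d -> col (dnext d).1 = ~~ col d.1.
Proof. by move/colP => /=; case: (col d.1); case: (col d.2). Qed.

Lemma col_iter d k : dart d -> col (iter k (@dnext G) d).1 = odd k (+) col d.1.
Proof. by move=> a; elim: k => //= k IH; rewrite col_dnext ?dart_iter // IH addNb. Qed.

Lemma face_orbit d : face d = [set x in fingraph.orbit (@dnext G) d].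
Proof. by apply/setP=> x; rewrite !inE -fconnect_orbit. Qed.

Lemma card_face d : #|face d| = fingraph.order (@dnext G) d.
Proof.
rewrite face_orbit cardsE /fingraph.order; apply: eq_card => x.
by rewrite -fconnect_orbit.
Qed.

Lemma iter_order_dnext d : iter (fingraph.order (@dnext G) d) (@dnext G) d = d.
Proof. exact: (iter_order (@dnext_inj G)). Qed.

Lemma even_face d : dart d -> ~~ odd #|face d|.
Proof.
move=> a; have := col_iter (fingraph.order (@dnext G) d) a.
by rewrite iter_order_dnext card_face; case: odd => //=; case: (col _).
Qed.

Lemma iter_dnext_neq d k : 0 < k < #|face d| -> iter k (@dnext G) d != d.
Proof.
by rewrite card_face; apply: iter_neq.
Qed.

(** Parity leaves only length 2 to be excluded; there the next dart is the twin, so the edge would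
    have the same face on both sides. *)
Lemma inner_face_ge4 d : dart d -> face d != O -> 3 < #|face d|.
Proof.
move=> a f; have ev := even_face a.
suff : 2 < #|face d| by case: #|_| ev => [|[|[|[]]]].
have c1 : 0 < #|face d| by rewrite card_face fingraph.order_gt0.
suff : #|face d| != 2 by case: #|_| ev c1 => [|[|[|]]].
apply/eqP=> c2; have := iter_order_dnext d; rewrite -card_face c2 /= => e.
have t : dnext d = twin d.
  rewrite /twin [LHS]surjective_pairing /=; congr pair.
  by rewrite -[LHS]/((dnext (dnext d)).1) e.
case: (eqVneq (face (twin d)) O) => [h|n]; first by rewrite -t face_next in h; rewrite h eqxx in f.
have c : chord d by rewrite /chord a f n.
by have := chord_no_loop op c; rewrite -t face_next eqxx.
Qed.

Lemma boundary_is_cycle d : dart d -> face d != O -> is_cycle (boundary (face d)).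
Proof.
move=> a f; pose c := [seq x.1 | x <- fingraph.orbit (@dnext G) d].
have inj : {in fingraph.orbit (@dnext G) d &, injective fst}.
  move=> x y; rewrite -!fconnect_orbit => cx cy e.
  have ex : face d = face x by apply/faceP; rewrite inE.
  have ey : face d = face y by apply/faceP; rewrite inE.
  apply: (face_simple tc op) => //; rewrite -?ex -?ey //.
    by rewrite (@dart_face_mem _ d) ?inE.
  by rewrite (@dart_face_mem _ d) ?inE.
have fo x : (x \in fingraph.orbit (@dnext G) d) = (x \in face d) by rewrite face_orbit inE.
pose R u v := [exists x in face d, (x.1 == u) && (x.2 == v)].
have cR : path.cycle R c.
  rewrite cycle_map; have := cycle_orbit (@dnext_inj G) d.
  apply: (@sub_in_cycle _ (mem (fingraph.orbit (@dnext G) d))); last by apply/allP.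
  move=> x y xo _ /eqP <- /=; apply/existsP; exists x.
  by rewrite -fo xo !eqxx.
have uc : uniq c by rewrite map_inj_in_uniq ?fingraph.orbit_uniq.
exists c; split.
- by rewrite size_map size_orbit -card_face; apply: leq_trans (inner_face_ge4 a f).
- rewrite /ucycle uc andbT; apply: sub_cycle cR => u v /existsP[x /and3P[xf /eqP<- /eqP<-]].
  by have := dart_face_mem xf; rewrite a.
have nx x : x \in face d -> next c x.1 = x.2.
  move=> xf; have xc : x.1 \in c by apply: map_f; rewrite fo.
  have /existsP[y /and3P[yf /eqP e /eqP <-]] := next_cycle cR xc.
  by congr snd; apply: inj; rewrite ?fo.
apply/setP=> e; apply/imsetP/imsetP => [[x xf ->]|[u uc' ->]].
  exists x.1; last by rewrite nx.
  by apply: map_f; rewrite fo.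
have /mapP[x xo ->] := uc'; have xf : x \in face d by rewrite -fo.
by exists x; rewrite // nx.
Qed.

Lemma inner_face_cycle d : dart d -> face d != O -> face_cycle (boundary (face d)).
Proof.
move=> a f; split; first exact: boundary_is_cycle.
by exists (face d); rewrite // !inE f; apply/facesP; exists d.
Qed.

(** Links the adjacency of face cycles, which speaks of edge sets, to the count of faces. If two
    faces had the same boundary, two consecutive edges would be chords between the same two
    faces. *)
Lemma boundary_inj d d' : dart d -> dart d' -> face d != O -> face d' != O ->
  boundary (face d) = boundary (face d') -> face d = face d'.
Proof.
move=> a a' f f' e; apply/eqP/negPn/negP => ne.
have tw x : x \in face d -> face (twin x) = face d'.
  move=> xf; have : edge x \in boundary (face d') by rewrite -e; apply: imset_f.
  case/imsetP=> y /faceP yf /esym/edge_inj[] ey; last by rewrite ey twinK.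
  by move/faceP: xf ne => ->; rewrite ey yf eqxx.
have ch x : x \in face d -> chord x.
  move=> xf; rewrite /chord tw // f' andbT (dart_face_mem xf) a.
  by move/faceP: xf => <-.
have nd : dnext d \in face d by apply/faceP; rewrite face_next.
have := chord_simple op (ch _ (mem_face d)) (ch _ nd).
rewrite face_next !tw ?mem_face // => /(_ erefl erefl) /(congr1 fst) /= h.
by have := dart_neq a; rewrite h eqxx.
Qed.

(** Around a vertex the inner faces follow one another across chords, from one side of the outer
    dart to the other. *)
Lemma inner_connected (T : eqType) (g : {set V * V} -> T) :
    (forall d, chord d -> g (face d) = g (face (twin d))) ->
  forall d d', dart d -> dart d' -> face d != O -> face d' != O -> g (face d) = g (face d').
Proof.
move=> gc; have at_v d k : dart d -> face d = O -> 0 < k < fingraph.order (@turn G) d ->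
    g (face (iter k (@turn G) d)) = g (face (turn d)).
  move=> a f; elim: k => // -[|k] IH ko //.
  have ko' : 0 < k.+1 < fingraph.order (@turn G) d by case/andP: ko => _ /ltnW.
  rewrite -IH // [in LHS]iterS face_turn; apply/esym/gc/and3P; split.
  - by rewrite dart_iter_turn.
  - exact: (inner_turn tc).
  by rewrite -face_turn; apply: (inner_turn tc a f ko).
have at_o d d' : dart d -> dart d' -> d.1 = d'.1 -> face d = O -> face d' != O ->
    g (face d') = g (face (turn d)).
  move=> a a' e f f'; have c := turn_connect a a' e.
  rewrite -(iter_findex c) at_v // findex_max // andbT lt0n findex_eq0.
  by apply: contraNneq f' => <-; rewrite f.
(* An outer dart receives the value of the face across it, which makes [h] invariant under [twin]
   and [turn]. *)
pose h d := if face d == O then g (face (twin d)) else g (face d).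
suff hh d d' : dart d -> dart d' -> h d = h d'.
  by move=> d d' a a' f f'; have := hh d d' a a'; rewrite /h (negbTE f) (negbTE f').
apply: (dart_ind (g := h)) => {}d a; rewrite /h ?twinK ?face_turn.
  case: eqP => [f'|/eqP f']; case: eqP => [f|/eqP f] //.
    by have := twin_outer tc a f; rewrite f' eqxx.
  by rewrite -gc // /chord a f f'.
case: (eqVneq (face (twin d)) O) => [f'|f']; last first.
  by case: eqP => [//|/eqP f]; rewrite -gc // /chord a f f'.
have f : face d != O by rewrite -[d]twinK; apply: (twin_outer tc); rewrite ?dart_twin.
rewrite (negbTE f) -face_turn.
have at' : dart (turn d) by rewrite dart_turn.
have ft : face (turn d) = O by rewrite face_turn.
by rewrite (at_o _ _ at' a).
Qed.

End InnerFaces.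

(** * The chain of inner faces *)

Section ChainWalk.
Variable G : plane_graph.
Local Notation V := (vert G).
Local Notation O := (outer_face G).
Implicit Types (d x : V * V) (v w : V) (s : seq (V * V)).

Lemma run_ex d : exists m, (0 < m) &&
  ((iter m (@dnext G) d == d) || chord (iter m (@dnext G) d)).
Proof.
by exists #|face d|; rewrite {2}card_face iter_order_dnext eqxx card_face fingraph.order_gt0.
Qed.

(** Stopping after a full turn makes the search total; [next_chord d = d] means that the face has no
    chord other than possibly d. *)
Definition run d : nat := ex_minn (run_ex d).
Definition next_chord d : V * V := iter (run d) (@dnext G) d.
Definition cross d : V * V := twin (next_chord d).
Definition walk d k : V * V := iter k cross d.

Lemma run_gt0 d : 0 < run d.
Proof. by rewrite /run; case: ex_minnP => m /andP[]. Qed.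

Lemma next_chordP d : next_chord d = d \/ chord (next_chord d).
Proof.
by rewrite /next_chord /run; case: ex_minnP => m /andP[_ /orP[/eqP|]]; auto.
Qed.

Lemma run_le d : run d <= #|face d|.
Proof.
rewrite /run; case: ex_minnP => m _; apply.
by rewrite {2}card_face iter_order_dnext eqxx card_face fingraph.order_gt0.
Qed.

Lemma run_lt d k : 0 < k < run d ->
  iter k (@dnext G) d != d /\ ~~ chord (iter k (@dnext G) d).
Proof.
case/andP=> k0; rewrite /run; case: ex_minnP => m _ mi km.
by apply/andP; rewrite -negb_or; apply/negP=> h; have := mi k; rewrite k0 h leqNgt km => /(_ isT).
Qed.

Lemma face_next_chord d : face (next_chord d) = face d.
Proof. exact: face_iter. Qed.

Lemma dart_next_chord d : dart (next_chord d) = dart d.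
Proof. exact: dart_iter. Qed.

Lemma next_chord_mem d x : x \in face d -> exists2 k, k < #|face d| & x = iter k (@dnext G) d.
Proof.
rewrite [in x \in _]face_orbit inE -fconnect_orbit => c; exists (findex (@dnext G) d x).
  by rewrite card_face findex_max.
by rewrite iter_findex.
Qed.

Lemma run_next_chord_id d : next_chord d = d -> run d = #|face d|.
Proof.
move=> e; apply/eqP; rewrite eqn_leq run_le leqNgt; apply/negP=> lt.
have := @iter_dnext_neq _ d (run d); rewrite run_gt0 lt => /(_ isT) /eqP; exact.
Qed.

Lemma next_chord_id d x : next_chord d = d -> x \in face d -> x != d -> ~~ chord x.
Proof.
move=> /run_next_chord_id e /next_chord_mem[[|k] kf ->]; first by rewrite eqxx.
by case: (@run_lt d k.+1) => //; rewrite e.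
Qed.

Lemma walkS d k : walk d k.+1 = twin (next_chord (walk d k)).
Proof. by []. Qed.

Lemma face_walkS d k : face (twin (next_chord (walk d k))) = face (walk d k.+1).
Proof. by []. Qed.

Section Acyclic.
Hypotheses (tc : two_connected G) (op : outerplane G).

Lemma walk_inner d n : dart d -> face d != O ->
    (forall i, i < n -> chord (next_chord (walk d i))) ->
  forall i, i <= n -> dart (walk d i) /\ face (walk d i) != O.
Proof.
move=> a f cn [|i] // /cn /and3P[a' f' f'']; rewrite walkS dart_twin.
by split.
Qed.

(* The chords crossed between two visits to the same face would form a closed
   walk of chords. *)
Lemma walk_uniq d n :
    (forall i, i < n -> chord (next_chord (walk d i))) ->
    (forall i, 0 < i < n -> next_chord (walk d i) != walk d i) ->
  forall i j, i < j <= n -> face (walk d i) != face (walk d j).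
Proof.
move=> cn nb i j; elim/ltn_ind: j i => j IH i /andP[ij jn]; apply/negP=> /eqP e.
pose c k := next_chord (walk d k).
have ci : chord (c i) by apply/cn/(leq_trans ij).
pose s := [seq c k | k <- iota i (j - i)].
have distinct k l : i <= k < j -> i <= l < j -> face (c k) = face (c l) -> k = l.
  rewrite /c !face_next_chord => /andP[ik kj] /andP[il lj] f.
  case: (ltngtP k l) => // kl.
    by have := IH l lj k; rewrite kl f eqxx => /(_ (ltnW (leq_trans lj jn))).
  by have := IH k kj l; rewrite kl f eqxx => /(_ (ltnW (leq_trans kj jn))).
have ac : all (@chord G) s.
  apply/allP=> x /mapP[k]; rewrite mem_iota subnKC ?(ltnW ij) // => /andP[_ kj] ->.
  exact/cn/(leq_trans kj).
have pth l m : path (fun x y => face (twin x) == face y) (c l) [seq c k | k <- iota l.+1 m].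
  elim: m l => //= m IHm l.
  by rewrite face_walkS face_next_chord eqxx; apply: IHm.
have cw : closed_walk s.
  rewrite /s; have -> : j - i = (j - i.+1).+1 by rewrite subnSK.
  rewrite /=; apply/andP; split.
    exact: pth.
  rewrite (last_map c) /=; have -> : last i (iota i.+1 (j - i.+1)) = j.-1.
    have lst m l : last l (iota l.+1 m) = l + m.
      by elim: m l => [|m IHm] l /=; rewrite ?addn0 ?IHm ?addSnnS.
    by rewrite lst; lia.
  rewrite face_walkS prednK ?(leq_ltn_trans _ ij) //.
  by rewrite /c face_next_chord e.
have a : dart (c i) by have /and3P[] := ci.
have := acyclic op ac cw a; rewrite /mult2.
have -> : count_mem (c i) s = 1.
  rewrite /s; have -> : j - i = (j - i.+1).+1 by rewrite subnSK.
  rewrite /= eqxx; suff /count_memPn-> : c i \notin [seq c k | k <- iota i.+1 (j - i.+1)] by [].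
  apply/negP=> /mapP[k]; rewrite mem_iota subnKC // => /andP[ik kj] ek.
  by have := distinct i k _ _ (congr1 (@face G) ek); lia.
suff /count_memPn-> : twin (c i) \notin s by [].
apply/negP=> /mapP[l]; rewrite mem_iota subnKC ?(ltnW ij) // => /andP[il lj] el.
have fl : face (walk d i.+1) = face (walk d l) by rewrite -face_walkS el face_next_chord.
have [ji|ji] := ltnP i.+1 j.
  have li : l = i.+1.
    by symmetry; apply: distinct; rewrite ?il ?lj ?leqnSn ?ji // /c !face_next_chord.
  have := nb l; rewrite -/(c l) -el li walkS eqxx.
  by rewrite ltn0Sn (leq_trans ji jn) => /(_ isT).
have jE : j = i.+1 by apply/eqP; rewrite eqn_leq ji ij.
have li : l = i by lia.
by have := twin_neq a; rewrite el li eqxx.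
Qed.

(** Otherwise [walk_uniq] would give more distinct faces than there are sets of darts. *)
Lemma walk_stops d : dart d -> face d != O ->
  exists n, next_chord (walk d n) = walk d n /\
            forall i, i < n -> next_chord (walk d i) != walk d i.
Proof.
move=> a f; pose N := #|{set V * V}|.
have [/existsP[i ei]|/existsPn ne] := boolP [exists i : 'I_N.+1, next_chord (walk d i) == walk d i].
  have ex : exists n, next_chord (walk d n) == walk d n by exists i.
  case: (ex_minnP ex) => n /eqP en mn; exists n; split=> // k kn.
  by apply/negP=> /mn; rewrite leqNgt kn.
have nb k : k < N.+1 -> next_chord (walk d k) != walk d k by move=> kN; apply: (ne (Ordinal kN)).
have cn k : k < N.+1 -> chord (next_chord (walk d k)).
  by move=> /nb nk; case: (next_chordP (walk d k)) => // e; rewrite e eqxx in nk.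
have u : injective (fun k : 'I_N.+1 => face (walk d k)).
  have nb' i : 0 < i < N.+1 -> next_chord (walk d i) != walk d i by case/andP=> _ /nb.
  move=> k l e; apply/val_inj; have W := walk_uniq cn nb'.
  case: (ltngtP k l) => // kl.
    by have := W k l; rewrite kl e eqxx ltnW // => /(_ isT).
  by have := W l k; rewrite kl e eqxx ltnW // => /(_ isT).
by have := leq_card _ u; rewrite card_ord ltnn.
Qed.

(** Distinct faces share no dart. This is the source of the linear time bound. *)
Lemma walk_sum d n : dart d -> face d != O ->
    (forall i, i < n -> chord (next_chord (walk d i))) ->
    (forall i, 0 < i < n -> next_chord (walk d i) != walk d i) ->
  \sum_(i < n.+1) #|face (walk d i)| <= #|[set x | @dart G x]|.
Proof.
move=> a f cn nb; have W := walk_uniq cn nb.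
rewrite -sum1dep_card (eq_bigr (fun i : 'I_n.+1 => \sum_(x | dart x) (x \in face (walk d i)))); last first.
  move=> i _; rewrite -sum1_card [LHS]big_mkcond [RHS]big_mkcond /=; apply: eq_bigr => x _.
  have [ai _] := walk_inner a f cn (ltn_ord i : i <= n).
  case: ifP => [df|_]; last by rewrite if_same.
  by rewrite (dart_face_mem df) ai.
rewrite exchange_big /=; apply: leq_sum => x _.
have [/existsP[i di]|/existsPn h] := boolP [exists i : 'I_n.+1, x \in face (walk d i)].
  rewrite (bigD1 i) //= di big1 // => j ji; apply/eqP; rewrite eqb0; apply: contra ji => dj.
  have e : face (walk d i) = face (walk d j) by move/faceP: di => ->; move/faceP: dj => ->.
  apply/eqP/val_inj; case: (ltngtP j i) => //= ij.
    by have := W j i; rewrite ij e eqxx => /(_ (ltn_ord i)).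
  by have := W i j; rewrite ij e eqxx => /(_ (ltn_ord j)).
by rewrite big1 // => i _; rewrite (negbTE (h i)).
Qed.

(* [walk e i] is the dart by which the i-th face of the chain is entered; the
   next chord of an end face is its entry dart again. *)
Definition chain_walk e n : Prop :=
  [/\ dart e, face e != O, next_chord e = e, chord e = (0 < n)
    & (forall i, 0 < i < n -> next_chord (walk e i) != walk e i) /\
      next_chord (walk e n) = walk e n].

Lemma chain_walk_exists e : dart e -> face e != O -> next_chord e = e ->
  exists n, chain_walk e n.
Proof.
move=> a f ne; have [c|c] := boolP (chord e); last first.
  by exists 0; split; [| | |exact/negbTE|split=> // -[]].
have /and3P[_ _ ft] := c.
have [|n [en mn]] := walk_stops _ ft; first by rewrite dart_twin.
(* At an end face the next chord of e is e itself, so the walk from e is that from [twin e], one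
   step late. *)
have wS k : walk e k.+1 = walk (twin e) k by rewrite /walk iterSr {2}/cross ne.
exists n.+1; split=> //.
split; last by rewrite wS.
by case=> // i ni; rewrite wS; apply: mn.
Qed.

Section Chain.
Variables (e : V * V) (n : nat).
Hypothesis cw : chain_walk e n.

Lemma chain_chord i : i < n -> chord (next_chord (walk e i)).
Proof.
case: cw => a f ne ce [nb en] ni.
case: i ni => [|i] ni; first by rewrite /= ne ce.
case: (next_chordP (walk e i.+1)) => // h.
by have := nb i.+1 ni; rewrite h eqxx.
Qed.

Lemma chain_inner i : i <= n -> dart (walk e i) /\ face (walk e i) != O.
Proof. by case: cw => a f _ _ _; apply: walk_inner => //; apply: chain_chord. Qed.

Lemma chain_uniq i j : i <= n -> j <= n -> face (walk e i) = face (walk e j) -> i = j.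
Proof.
case: cw => _ _ _ _ [nb _] ni nj f; have W := walk_uniq chain_chord nb.
case: (ltngtP i j) => // ij.
  by have := W i j; rewrite ij f eqxx => /(_ nj).
by have := W j i; rewrite ij f eqxx => /(_ ni).
Qed.

Lemma chain_entry i : 0 < i <= n -> chord (walk e i).
Proof. by case: i => // i ni; rewrite walkS chord_twin; apply: chain_chord. Qed.

End Chain.
End Acyclic.

Lemma card_darts : #|[set d | @dart G d]| <= 2 * #|edges G|.
Proof.
rewrite -sum1dep_card (partition_big (@edge G) (mem (edges G))) /=; last exact: edges_dart.
rewrite mulnC -sum_nat_const; apply: leq_sum => _ /edgesP[x ax ->].
rewrite sum1dep_card; apply: leq_trans (subset_leq_card (_ : _ \subset [set x; twin x])) _.
  by apply/subsetP=> d; rewrite !inE => /andP[_ /eqP/esym/edge_inj[]->]; rewrite eqxx ?orbT.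
by rewrite cards2; case: (_ != _).
Qed.

(** * In a chain all inner faces lie on one walk *)

Section EvenChain.
Variable epc : even_polygonal_chain G.

(** By [chord_simple] and [boundary_inj] three chords of a face lead to three different adjacent
    face cycles. *)
Lemma two_chords d d1 d2 d3 : face d != O ->
  [/\ d1 \in face d, d2 \in face d & d3 \in face d] ->
  [/\ chord d1, chord d2 & chord d3] -> uniq [:: d1; d2; d3] -> False.
Proof.
case: epc => tc [col colP] op two f [m1 m2 m3] [c1 c2 c3] u.
have c x : x \in [:: d1; d2; d3] -> chord x /\ face x = face d.
  by rewrite !inE => /or3P[]/eqP->; split=> //; apply/esym/faceP.
pose B x := boundary (face (twin x)).
have fB x : chord x -> face_cycle (B x).
  by move=> /and3P[ax _ ft]; apply: (inner_face_cycle tc op colP); rewrite ?dart_twin.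
have ad x : x \in [:: d1; d2; d3] -> dart x /\ dart (twin x).
  by move=> /c[/and3P[]]; rewrite dart_twin.
have fd : face_cycle (boundary (face d)).
  apply: (inner_face_cycle tc op colP) => //; have /and3P[a1 _ _] := c1.
  by rewrite -(dart_face_mem m1).
have ax : dart d by have /and3P[a1 _ _] := c1; rewrite -(dart_face_mem m1).
suff : size [seq B x | x <- [:: d1; d2; d3]] <= 2 by rewrite size_map.
apply: (two _ fd); last first.
  move=> _ /mapP[x xs ->]; have [cx fx] := c x xs; split; first exact: fB.
  have /and3P[_ _ ft] := cx; have [ax1 ax2] := ad x xs; split; last first.
    apply/set0Pn; exists (edge x); rewrite inE; apply/andP; split.
      by apply/imsetP; exists x => //; apply/faceP.
    by rewrite -edge_twin; apply/imset_f/mem_face.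
  apply/negP=> /eqP/(boundary_inj op) E; have := chord_no_loop op cx.
  by rewrite fx E ?eqxx.
rewrite map_inj_in_uniq // => x y xs ys e.
have [cx fx] := c x xs; have [cy fy] := c y ys; have [_ a1] := ad x xs; have [_ a2] := ad y ys.
have /and3P[_ _ ftx] := cx; have /and3P[_ _ fty] := cy.
by apply: (chord_simple op) => //; rewrite ?fx ?fy //; apply: (boundary_inj op).
Qed.

Lemma chain_chords e n i d : chain_walk e n -> i <= n -> chord d ->
  face d = face (walk e i) ->
  i < n /\ d = next_chord (walk e i) \/ 0 < i /\ d = walk e i.
Proof.
move=> cw ni c fd; have [tc _ op _] := epc; have [a f] := chain_inner cw ni.
have dm : d \in face (walk e i) by apply/faceP.
have [di|di] := eqVneq d (walk e i).
  case: i ni di {fd a f dm} => [|i] ni di; last by right.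
  (* The entry dart of face 0 is also its exit, and it is a chord only if 0 < n. *)
  left; case: cw => _ _ -> ce _; split=> //; by rewrite -ce -[e]/(walk e 0) -di.
have nn : next_chord (walk e i) != walk e i.
  by apply/negP=> /eqP/next_chord_id /(_ dm di); rewrite c.
have lt : i < n.
  by rewrite ltn_neqAle ni andbT; apply: contraNneq nn => ->; case: cw => _ _ _ _ [_ ->].
left; split=> //; apply/eqP/negPn/negP => dn.
have i0 : 0 < i by case: i {ni fd a f dm di lt dn} nn => //; case: cw => _ _ ->; rewrite eqxx.
apply: (@two_chords (walk e i) d (walk e i) (next_chord (walk e i)) f).
- by split=> //; [apply: mem_face|apply/faceP; rewrite face_next_chord].
- by split=> //; [apply: (chain_entry cw); rewrite i0|apply: chain_chord cw _ _].
by rewrite /= !inE negb_or di dn eq_sym nn.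
Qed.

(** By [chain_chords] the faces on the walk are closed under crossing chords, so [inner_connected]
    reaches them all. *)
Lemma chain_cover e n d : chain_walk e n -> dart d -> face d != O ->
  exists2 i, i <= n & face d = face (walk e i).
Proof.
move=> cw a f; have [tc _ op _] := epc.
pose g (h : {set V * V}) := [exists i : 'I_n.+1, h == face (walk e i)].
have [ae fe _ _ _] := cw.
have ge : g (face (walk e 0)) by apply/existsP; exists ord0.
suff /existsP[i /eqP] : g (face d) by exists i; rewrite // -ltnS.
rewrite (inner_connected (g := g) tc _ a ae f fe) // => {a f} {}d cd.
have half x : chord x -> g (face x) -> g (face (twin x)).
  move=> cx /existsP[[i] ni /= /eqP fx].
  case: (chain_chords cw (ni : i <= n) cx fx) => [[lt ->]|[]].
    by apply/existsP; exists (Ordinal (lt : i.+1 < n.+1)); rewrite face_walkS.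
  case: i ni fx => // i ni fx _ ->; rewrite walkS twinK face_next_chord.
  by apply/existsP; exists (Ordinal (ltnW ni)).
by apply/idP/idP=> h; [|rewrite -[d]twinK]; apply: half; rewrite ?chord_twin.
Qed.

End EvenChain.
End ChainWalk.

(** * Perfect matchings *)

Lemma drops_rises (z : nat -> bool) n :
  \sum_(i < n) (z i && ~~ z i.+1) + z n = z 0 + \sum_(i < n) (~~ z i && z i.+1).
Proof.
elim: n => [|n IH]; first by rewrite !big_ord0 addn0.
rewrite !big_ord_recr /= addnA -IH; by case: (z n); case: (z n.+1); rewrite /= ?addn0 // ?addn1.
Qed.

Section Matchings.
Variable G : plane_graph.
Local Notation V := (vert G).
Local Notation O := (outer_face G).
Implicit Types (d : V * V) (v w : V) (M : {set {set V}}) (x : {set V * V} -> bool).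
Hypotheses (tc : two_connected G) (op : outerplane G).
Variable col : V -> bool.
Hypothesis colP : forall u v, adj u v -> col u != col v.

Lemma col_twin d : dart d -> col d.2 = ~~ col d.1.
Proof. by move/colP; case: (col d.1); case: (col d.2). Qed.

Lemma card_incident M v : M \subset edges G ->
  #|[set e in M | v \in e]| = \sum_(w | adj v w) (edge (v, w) \in M).
Proof.
move=> /subsetP sM; rewrite -big_mkcondr /= sum1dep_card.
have inj : {in [set w | adj v w & edge (v, w) \in M] &, injective (fun w => edge (v, w))}.
  move=> w w' _; rewrite inE => /andP[a' _] /edge_inj[[]|[_ e]] //.
  by rewrite e adj_irrefl in a'.
rewrite -[RHS](card_in_imset inj); apply: eq_card => e; rewrite inE.
apply/andP/imsetP => [[eM ve]|[w]]; last first.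
  by rewrite inE => /andP[_ eM] ->; rewrite !inE eqxx.
have /edgesP[[a b] ab E] := sM e eM; move: ve; rewrite E !inE /= => /orP[]/eqP->.
  by exists b; rewrite // inE -E eM andbT.
exists a; last by rewrite -(edge_twin (a, b)).
by rewrite inE -(edge_twin (b, a)) -E eM andbT adj_sym.
Qed.

Lemma rotation_sum v (F : V * V -> nat) :
  \sum_(w | adj v w) F (v, w)
    = \sum_(i < fingraph.order (@turn G) (outd op v)) F (iter i (@turn G) (outd op v)).
Proof.
set o := outd op v; have ao : dart o := outd_dart op v.
transitivity (\sum_(d <- fingraph.orbit (@turn G) o) F d).
  rewrite -big_filter -(big_map (fun w => (v, w)) xpredT); apply: perm_big.
  apply: uniq_perm; rewrite ?fingraph.orbit_uniq ?map_inj_uniq ?filter_uniq ?index_enum_uniq //.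
    by move=> w w' [].
  move=> d; rewrite -fconnect_orbit; apply/mapP/idP => [[w]|c].
    by rewrite mem_filter => /andP[a _] ->; apply: turn_connect.
  have od : dart d /\ d.1 = v.
    by rewrite -(iter_findex c) dart_iter_turn iter_turn1.
  exists d.2; last by case: od => _ <-; case: (d).
  by rewrite mem_filter mem_index_enum andbT; case: od => a <-.
rewrite /fingraph.orbit; move: (fingraph.order _ o) => n.
elim: n o {ao} => [|n IH] o; first by rewrite big_nil big_ord0.
by rewrite trajectS big_cons big_ord_recl IH; congr addn; apply: eq_bigr => i _; rewrite iterSr.
Qed.

(* The exterior face has value 1 on the left of an edge and 0 on its right. *)
Definition from_left x (f : {set V * V}) : bool := (f == O) || x f.
Definition from_right x (f : {set V * V}) : bool := (f != O) && x f.

Definition matching_of x : {set {set V}} :=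
  [set edge d | d in [pred d | [&& dart d, col d.1, from_left x (face d)
                                 & ~~ from_right x (face (twin d))]]].

(** Seen from the end of colour true: the value on the left of the chord is at least the value on
    its right. *)
Definition monotone x : Prop := forall d, chord d ->
  (x (face d) == col d.1) || (x (face (twin d)) == col d.2).

Lemma matching_ofE x d : dart d -> (edge d \in matching_of x) =
  if col d.1 then from_left x (face d) && ~~ from_right x (face (twin d))
  else from_left x (face (twin d)) && ~~ from_right x (face d).
Proof.
move=> a; have ct := col_twin a; apply/imsetP/idP => [[d']|].
  rewrite !inE => /and4P[a' c l r] /edge_inj[] E.
    by rewrite -E c l.
  by rewrite E /= in c l r *; rewrite ct in c; rewrite (negbTE c) l -[d]twinK r.
case: ifP => c /andP[l r]; first by exists d; rewrite // !inE a c l.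
by exists (twin d); rewrite ?edge_twin // !inE dart_twin a /= ct c l twinK.
Qed.

Lemma matching_of_edges x : matching_of x \subset edges G.
Proof. by apply/subsetP=> e /imsetP[d]; rewrite !inE => /andP[a _] ->; apply: edges_dart. Qed.

Lemma matching_of_outer x d : dart d -> face (twin d) = O ->
  (edge d \in matching_of x) = (x (face d) == col d.1).
Proof.
move=> a f; have f' : face d != O by rewrite -[d]twinK; apply: (twin_outer tc); rewrite ?dart_twin.
rewrite matching_ofE // /from_left /from_right f eqxx (negbTE f') /=.
by case: (col _); case: (x _).
Qed.

Lemma matching_of_chord x d : chord d ->
  (edge d \in matching_of x) = (x (face d) == col d.1) && (x (face (twin d)) == col d.2).
Proof.
case/and3P=> a f f'; rewrite matching_ofE // /from_left /from_right (negbTE f) (negbTE f') /=.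
by rewrite col_twin //; case: (col _); case: (x _); case: (x _).
Qed.

Section Vertex.
Variables (x : {set V * V} -> bool) (v : V).
Local Notation o := (outd op v).
Local Notation deg := (fingraph.order (@turn G) o).
Local Notation dt i := (iter i (@turn G) o).

(** The face values met around v, complemented where v has colour false. The exterior face stands at
    both ends, as true and as false, in accordance with [from_left] and [from_right]. *)
Definition profile i : bool :=
  if i == 0 then true else if i == deg then false else x (face (dt i)) == col v.

Lemma deg_gt1 : 1 < deg.
Proof.
rewrite ltn_neqAle fingraph.order_gt0 andbT; apply/negP=> /eqP e.
have := iter_order (@turn_inj G) o; rewrite -e /= => t.
have := twin_outer tc (outd_dart op v) (outd_face op v).
by rewrite -face_turn t outd_face eqxx.
Qed.

Lemma dart_dt i : dart (dt i).
Proof. by rewrite dart_iter_turn outd_dart. Qed.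

Lemma twin_dt i : i < deg -> face (twin (dt i)) = face (dt i.+1).
Proof. by rewrite iterS face_turn. Qed.

Lemma dt_deg : dt deg = o.
Proof. exact: (iter_order (@turn_inj G)). Qed.

Lemma dt_inner i : 0 < i < deg -> face (dt i) != O.
Proof. by move=> h; apply: (inner_turn tc) h; rewrite ?outd_dart ?outd_face. Qed.

Lemma chord_dt i : 0 < i -> i.+1 < deg -> chord (dt i).
Proof.
move=> i0 id; apply/and3P; split; first exact: dart_dt.
  by apply: dt_inner; rewrite i0 ltnW.
by rewrite twin_dt 1?ltnW //; apply: dt_inner.
Qed.

Lemma matching_of_dt i : i < deg -> (edge (dt i) \in matching_of x) = profile i && ~~ profile i.+1.
Proof.
move=> id; rewrite matching_ofE ?dart_dt // iter_turn1 twin_dt // /profile /=.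
rewrite /from_left /from_right.
have -> : (i == deg) = false by rewrite ltn_eqF.
have fO k : k <= deg -> (face (dt k) == O) = (k == 0) || (k == deg).
  rewrite leq_eqVlt => /predU1P[->|kd]; first by rewrite dt_deg outd_face eqxx eqxx orbT.
  case: k kd => [|k] kd; first by rewrite outd_face eqxx.
  by rewrite /= (negbTE (dt_inner (_ : 0 < k.+1 < deg))) // (ltn_eqF kd).
rewrite -![turn (dt i)]/(dt i.+1) !fO ?(ltnW id) // (ltn_eqF id) orbF /=.
by case: (i == 0); case: (i.+1 == deg); case: (col v); case: (x _); case: (x _).
Qed.

Lemma drops_profile : \sum_(i < deg) (profile i && ~~ profile i.+1)
  = (\sum_(i < deg) (~~ profile i && profile i.+1)).+1.
Proof.
have := drops_rises profile deg; rewrite /profile eqxx; case: eqP => [e|_].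
  by have := fingraph.order_gt0 (@turn G) o; rewrite e.
by rewrite addn0 => ->.
Qed.

(** Matched edges at v are the drops of the profile, which starts at true and ends at false: it
    drops once more than it rises. So v is covered once iff there is no rise. *)
Lemma card_matching_of : #|[set e in matching_of x | v \in e]|
  = (\sum_(i < deg) (~~ profile i && profile i.+1)).+1.
Proof.
rewrite card_incident ?matching_of_edges // (rotation_sum v (fun d => (edge d \in _) : nat)).
by rewrite -drops_profile; apply: eq_bigr => i _; rewrite matching_of_dt.
Qed.

End Vertex.

Lemma matching_of_perfect x : monotone x -> perfect_matching (edges G) (matching_of x).
Proof.
move=> m; rewrite /perfect_matching matching_of_edges; apply/forallP=> v.
rewrite card_matching_of big1 // => i _; apply/eqP; rewrite eqb0; apply/negP=> /andP[n1 p2].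
move: n1 p2; rewrite /profile (ltn_eqF (ltn_ord i)) /=; case: (posnP i) => // i0 n1.
case: eqP => // /eqP ni.
have id : i.+1 < fingraph.order (@turn G) (outd op v) by rewrite ltn_neqAle ni /=.
have := m _ (chord_dt i0 id); rewrite iter_turn1 (negbTE n1) /=.
rewrite twin_dt // col_twin ?dart_dt // iter_turn1.
by case: (col v); case: (x _).
Qed.

(** M and the matching of the zero valuation differ by a set that is even at every vertex, which
    [homology] writes as a boundary. *)
Lemma matching_of_surj M : perfect_matching (edges G) M ->
  exists2 x, monotone x & M = matching_of x.
Proof.
case/andP=> sM /forallP pM.
have m0 : monotone xpred0.
  by move=> d /and3P[/col_twin-> _ _]; case: (col _).
have /andP[_ /forallP p0] := matching_of_perfect m0.
pose B d := (edge d \in M) (+) (edge d \in matching_of xpred0).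
have [||Y BY] := @homology G B; first by move=> d _; rewrite /B edge_twin.
  move=> v; have odd_sum (F : V -> nat) :
      odd (\sum_(w | adj v w) F w) = \big[addb/false]_(w | adj v w) odd (F w).
    exact: (big_morph odd oddD erefl).
  rewrite odd_sum (eq_bigr (fun w : V => odd ((edge (v, w) \in M) + (edge (v, w) \in matching_of xpred0)))).
    by rewrite -odd_sum big_split /= -!card_incident ?matching_of_edges // (eqP (pM v)) (eqP (p0 v)).
  by move=> w _; rewrite oddD !oddb.
(* Y is determined up to complement only; this normalises the exterior face to 0. *)
pose x f := Y f (+) Y O.
have Mout d : dart d -> face (twin d) = O -> (edge d \in M) = (x (face d) == col d.1).
  move=> a f; have := BY d a; rewrite /B matching_of_outer // f /x.
  by case: (_ \in M); case: (col _); case: (Y _); case: (Y _).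
have Mch d : chord d -> (edge d \in M) = (x (face d) != x (face (twin d))).
  move=> c; have /and3P[a _ _] := c; have := BY d a.
  rewrite /B matching_of_chord // col_twin // /x.
  by case: (_ \in M); case: (col _); case: (Y _); case: (Y _); case: (Y _).
have Mdt v i : i < fingraph.order (@turn G) (outd op v) ->
    (edge (iter i (@turn G) (outd op v)) \in M) = (profile x v i != profile x v i.+1).
  move=> id; rewrite /profile (ltn_eqF id) /=.
  have [i0|i0] := posnP i.
    have d1 := deg_gt1 v; rewrite i0 (ltn_eqF d1) /= -(edge_twin (outd op v)).
    rewrite Mout ?dart_twin ?outd_dart ?twinK ?outd_face //= -face_turn.
    by rewrite (col_twin (outd_dart op v)) /=; case: (col v); case: (x _).
  have [e|ne] := eqVneq i.+1 (fingraph.order (@turn G) (outd op v)).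
    rewrite Mout ?dart_dt ?iter_turn1 ?twin_dt //; last by rewrite e dt_deg outd_face.
    by case: (_ == _).
  rewrite Mch; last by apply: chord_dt; rewrite // ltn_neqAle ne.
  by rewrite twin_dt //; case: (col v); case: (x _); case: (x _).
have mx : monotone x.
  move=> d c; have /and3P[a f ft] := c.
  have := pM d.1; rewrite card_incident //; rewrite (rotation_sum d.1 (fun d => (edge d \in M) : nat)).
  rewrite (eq_bigr (fun i : 'I_(fingraph.order (@turn G) (outd op d.1)) =>
    (profile x d.1 i && ~~ profile x d.1 i.+1) + (~~ profile x d.1 i && profile x d.1 i.+1))); last first.
    by move=> i _; rewrite Mdt //; case: (profile _ _ _); case: (profile _ _ _).
  (* One edge of M at [d.1] means one change of the profile; as a drop always occurs, there is no
     rise. *)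
  rewrite big_split /= drops_profile addSn eqSS addn_eq0 andbb sum_nat_eq0 => /forallP r0.
  have cn := turn_connect (outd_dart op d.1) a erefl; set i := findex (@turn G) (outd op d.1) d.
  have id : i < fingraph.order (@turn G) (outd op d.1) by apply: findex_max.
  have := r0 (Ordinal id); rewrite /= eqb0 /profile (ltn_eqF id) /=.
  have i0 : i != 0 by rewrite findex_eq0; apply: contraNneq f => <-; rewrite outd_face.
  have di : iter i (@turn G) (outd op d.1) = d by apply: iter_findex.
  have i1 : i.+1 != fingraph.order (@turn G) (outd op d.1).
    by apply: contraNneq ft => e; rewrite -di twin_dt // e dt_deg outd_face.
  rewrite (negbTE i0) (negbTE i1) -iterS iterS -[iter i _ _]/(iter i (@turn G) (outd op d.1)) di.
  by rewrite face_turn col_twin //; case: (col _); case: (x _); case: (x _).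
exists x => //; apply/setP=> e.
have [/edgesP[d a ->]|ne] := boolP (e \in edges G); last first.
  by rewrite (negbTE (contra (subsetP sM e) ne)) (negbTE (contra (subsetP (matching_of_edges x) e) ne)).
have [f|f] := eqVneq (face (twin d)) O; first by rewrite Mout ?matching_of_outer.
have [f'|f'] := eqVneq (face d) O.
  by rewrite -(edge_twin d) Mout ?matching_of_outer ?dart_twin ?twinK.
have c : chord d by rewrite /chord a f f'.
rewrite Mch // matching_of_chord //; have := mx d c; rewrite col_twin //.
by case: (col _); case: (x _); case: (x _).
Qed.

End Matchings.

(** * Anti-forcing numbers *)

Section Spectrum.
Variable G : plane_graph.
Local Notation V := (vert G).
Local Notation O := (outer_face G).
Implicit Types (d : V * V) (v w : V) (M S : {set {set V}}) (x : {set V * V} -> bool).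

(** Entry and exit have the same parity on the face iff the run between them is even. An end face
    returns to its entry dart after an even run and counts as [Turn], even when it is a square. *)
Definition chain_type (e : V * V) (i : nat) : face_type :=
  if odd (run (walk e i)) then Mono else
  if (next_chord (walk e i) != walk e i) && (#|face (walk e i)| == 4) then Tight else Turn.

Hypothesis epc : even_polygonal_chain G.
Variable e : V * V.
Variable n : nat.
Hypothesis cw : chain_walk e n.

Let tc : two_connected G. Proof. by case: epc. Qed.
Let op : outerplane G. Proof. by case: epc. Qed.

Variable col : V -> bool.
Hypothesis colP : forall u v, adj u v -> col u != col v.

Local Notation en i := (walk e i).
Local Notation ex i := (next_chord (walk e i)).
Local Notation t := (chain_type e).
Local Notation out p i := (exit_bit (t i) (p i)).

Lemma chain_type_end i : i <= n -> ex i = en i -> t i = Turn.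
Proof.
move=> ni E; have [a _] := chain_inner cw ni.
by rewrite /chain_type E eqxx (run_next_chord_id E) (negbTE (even_face colP a)).
Qed.

Lemma chain_type0 : t 0 = Turn.
Proof. by apply: chain_type_end => //; case: cw. Qed.

Lemma chain_typen : t n = Turn.
Proof. by apply: chain_type_end => //; case: cw => _ _ _ _ []. Qed.

(* The letters of [word x] are relative to the entry chords, see [face_type]. *)
Definition word x (i : nat) : bool := x (face (en i)) == col (en i).1.

Definition value_of (p : nat -> bool) (f : {set V * V}) : bool :=
  [exists i : 'I_n.+1, (f == face (en i)) && (p i == col (en i).1)].

Lemma value_ofE p i : i <= n -> value_of p (face (en i)) = (p i == col (en i).1).
Proof.
move=> ni; apply/existsP/idP => [[j /andP[/eqP f]]|pi]; last first.
  by exists (Ordinal (ni : i < n.+1)); rewrite eqxx.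
by rewrite (chain_uniq tc op cw ni _ f) // -ltnS.
Qed.

Lemma word_value_of p i : i <= n -> word (value_of p) i = p i.
Proof. by move=> ni; rewrite /word value_ofE //; case: (p i); case: (col _). Qed.

Lemma word_exit x i : i <= n -> out (word x) i = (x (face (en i)) == col (ex i).1).
Proof.
move=> ni; have [a _] := chain_inner cw ni.
rewrite /next_chord (col_iter colP _ a) /chain_type /word.
case: (odd _); first by rewrite /=; case: (x _); case: (col _).
by rewrite addFb; case: ifP.
Qed.

Lemma word_chord x i : i < n ->
  (edge (ex i) \in matching_of col x) = out (word x) i && word x i.+1.
Proof.
move=> ni; rewrite (matching_of_chord colP _ (chain_chord cw ni)) face_next_chord.
by rewrite word_exit // ltnW.
Qed.

Lemma monotoneP x : monotone col x <-> valid t (word x) n.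
Proof.
split=> [m i ni|v d c].
  by have := m _ (chain_chord cw ni); rewrite face_next_chord word_exit 1?ltnW.
have /and3P[a f _] := c; have [i ni fi] := chain_cover epc cw a f.
case: (chain_chords epc cw ni c fi) => [[lt ->]|[i0 ->]].
  by have := v i lt; rewrite word_exit // face_next_chord.
case: i i0 ni {fi} => // i _ ni; have := v i ni.
rewrite word_exit 1?ltnW // orbC walkS twinK face_next_chord.
by rewrite -[(twin (ex i)).2]/((ex i).1).
Qed.

Lemma edge_cases d : dart d ->
  (exists2 i, i < n & edge d = edge (ex i)) \/
  (exists i d', [/\ i <= n, dart d', face d' = face (en i), face (twin d') = O & edge d = edge d']).
Proof.
move=> a; have [f|f] := eqVneq (face d) O.
  right; have f' := twin_outer tc a f; have a' : dart (twin d) by rewrite dart_twin.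
  have [i ni fi] := chain_cover epc cw a' f'.
  by exists i, (twin d); rewrite twinK edge_twin.
have [i ni fi] := chain_cover epc cw a f.
have [f'|f'] := eqVneq (face (twin d)) O; first by right; exists i, d.
have c : chord d by apply/and3P.
left; case: (chain_chords epc cw ni c fi) => [[lt ->]|[i0 ->]]; first by exists i.
by case: i i0 ni {fi} => // i _ ni; exists i; rewrite // walkS edge_twin.
Qed.

(** Every other dart of the face has colour c. If all of these were chords, a face longer than 4
    would have three chords, and a square would have its two chords opposite, one being the entry:
    the [Tight] case. *)
Lemma class_nonempty i c : i <= n -> ~ (t i = Tight /\ c = col (en i).1) ->
  exists d, [/\ dart d, face d = face (en i), face (twin d) = O & col d.1 = c].
Proof.
move=> ni nt; have [a f] := chain_inner cw ni.
pose s := iter (c != col (en i).1) (@dnext G) (en i).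
have as_ : dart s by rewrite dart_iter.
have cs : col s.1 = c by rewrite (col_iter colP) //; case: (c); case: (col _).
have fs : face s = face (en i) by rewrite face_iter.
pose q k := iter (2 * k) (@dnext G) s.
have qP k : [/\ dart (q k), face (q k) = face (en i) & col (q k).1 = c].
  by rewrite dart_iter face_iter (col_iter colP) // oddM.
have ch k : (exists d, [/\ dart d, face d = face (en i), face (twin d) = O
    & col d.1 = c]) \/ chord (q k).
  have [ak fk ck] := qP k; case: (eqVneq (face (twin (q k))) O) => [h|h].
    by left; exists (q k).
  by right; apply/and3P; rewrite fk.
have ne k l : k < l -> 2 * (l - k) < #|face (en i)| -> q k != q l.
  move=> kl lf; have -> : q l = iter (2 * (l - k)) (@dnext G) (q k).
    by rewrite -iterD; congr iter; lia.
  have [_ fk _] := qP k; rewrite eq_sym; apply: iter_dnext_neq.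
  by rewrite fk lf andbT; lia.
case: (ch 0) => // c0; case: (ch 1) => // c1.
have ge4 := inner_face_ge4 op colP a f.
have n01 : q 0 != q 1 by apply: ne => //; apply: ltnW.
have [_ f0 k0] := qP 0; have [_ f1 k1] := qP 1.
have in2 k : chord (q k) -> (q k = ex i /\ ex i != en i) \/ q k = en i.
  have [_ fk _] := qP k => ck; case: (chain_chords epc cw ni ck fk) => [[lt E]|[_ ->]]; last by right.
  by case: (eqVneq (ex i) (en i)) => [h|h]; [right; rewrite E|left].
case: (ltnP 4 #|face (en i)|) => [gt4|le4].
  case: (ch 2) => // c2; exfalso.
  apply: (@two_chords G epc (en i) (q 0) (q 1) (q 2) f).
  - by have [_ f2 _] := qP 2; split; apply/faceP; rewrite ?f0 ?f1 ?f2.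
  - by split.
  by rewrite /= !inE negb_or n01 !ne //; apply: ltnW; apply: ltnW.
exfalso; apply: nt.
have [E0 E1] : ex i != en i /\ col (ex i).1 = c /\ col (en i).1 = c.
  move: n01 k0 k1; case: (in2 0 c0) => [[-> h]|->]; case: (in2 1 c1) => [[-> h']|->]; rewrite ?eqxx //.
case: E1 => E1 E2; split=> //.
rewrite /chain_type E0; have -> : #|face (en i)| == 4 by rewrite eqn_leq le4 ge4.
have := col_iter colP (run (en i)) a; rewrite -/(ex i) E1 E2.
by case: (odd _) => //=; case: (c).
Qed.

(** An exterior edge of the parity opposite to the entry exists even at a [Tight] face, and it shows
    the letter. *)
Lemma matching_of_inj x y : matching_of col x = matching_of col y ->
  forall i, i <= n -> word x i = word y i.
Proof.
move=> E i ni; have [|d [a f ft _]] := @class_nonempty i (~~ col (en i).1) ni.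
  by case=> _; case: (col _).
have := matching_of_outer tc colP x a ft; rewrite E (matching_of_outer tc colP) // f /word.
by case: (x _); case: (y _); case: (col _); case: (col _).
Qed.

Lemma matching_of_word x y : (forall i, i <= n -> word x i = word y i) ->
  matching_of col x = matching_of col y.
Proof.
move=> E; apply/setP=> b.
have [/edgesP[d a ->]|nb] := boolP (b \in edges G); last first.
  by rewrite !(negbTE (contra (subsetP (matching_of_edges col _) b) nb)).
case: (edge_cases a) => [[i ni ->]|[i [d' [ni a' f' ft' ->]]]].
  by rewrite !word_chord // /exit_bit !E // ltnW.
rewrite !(matching_of_outer tc colP) // f'.
by have := E i ni; rewrite /word; case: (x _); case: (y _); case: (col _).
Qed.

(** In such a square the darts at distances 0 and 2 from the entry are the two chords, so exterior
    darts are at distance 1 or 3. *)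
Lemma tight_class i d : i <= n -> t i = Tight -> dart d -> face d = face (en i) ->
  face (twin d) = O -> col d.1 <> col (en i).1.
Proof.
move=> ni ti a f ft cd; have [ai _] := chain_inner cw ni.
move: ti; rewrite /chain_type; case: ifP => // /negbT er; case: ifP => // /andP[ne /eqP f4] _.
have ce : chord (ex i) by case: (next_chordP (en i)) => // E; rewrite E eqxx in ne.
have cn : chord (en i).
  apply: (chain_entry cw); rewrite ni andbT lt0n; apply: contraNneq ne => ->.
  by case: cw => _ _ ->.
have nd : ~~ chord d by rewrite /chord ft eqxx !andbF.
have r2 : run (en i) = 2.
  have := run_gt0 (en i); have := run_le (en i); rewrite f4.
  have : run (en i) != 4.
    by apply: contraNneq ne => r4; rewrite /next_chord r4 -f4 card_face iter_order_dnext.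
  by case: (run _) er => [|[|[|[|[]]]]].
have /next_chord_mem[k] : d \in face (en i) by apply/faceP.
rewrite f4 => k4 dk; move: cd nd; rewrite dk (col_iter colP) //.
case: k k4 {dk} => [|[|[|[|k]]]] //= _.
- by rewrite cn.
- by case: (col _).
- by rewrite -[dnext (dnext _)]/(iter 2 (@dnext G) (en i)) -r2 ce.
by case: (col _).
Qed.

Lemma perfect_matchingD S M : perfect_matching (edges G :\: S) M <->
  perfect_matching (edges G) M /\ (forall b, b \in M -> b \notin S).
Proof.
rewrite /perfect_matching subsetD disjoint_subset.
split=> [/andP[/andP[-> /subsetP d] ->]|[/andP[-> ->] h]]; first by split=> // b /d.
by rewrite andbT; apply/subsetP=> b /h.
Qed.

Lemma value_of_monotone p : valid t p n -> monotone col (value_of p).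
Proof.
move=> v; apply/monotoneP; apply: eq_valid v => i ni; by rewrite word_value_of.
Qed.

Definition outer_edge (i : nat) (b : {set V}) : bool :=
  [exists d, [&& dart d, face d == face (en i), face (twin d) == O & edge d == b]].

(** No edge of an anti-forcing set is charged twice, neither to two letters or chords nor to one of
    each; in [af_lower] this bounds the cost by the size of the set. *)
Lemma edge_index_le1 (b : {set V}) :
  \sum_(i < n.+1) outer_edge i b + \sum_(i < n) (b == edge (ex i)) <= 1.
Proof.
have uo i j : i <= n -> j <= n -> outer_edge i b -> outer_edge j b -> i = j.
  move=> ni nj /existsP[d /and4P[a /eqP f /eqP ft /eqP E]].
  move=> /existsP[d' /and4P[a' /eqP f' /eqP ft' /eqP]]; rewrite -E => /esym/edge_inj[] E'.
    by apply: (chain_uniq tc op cw ni nj); rewrite -f -f' E'.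
  by have [_] := chain_inner cw nj; rewrite -f' E' ft eqxx.
have uc i j : i < n -> j < n -> b = edge (ex i) -> b = edge (ex j) -> i = j.
  move=> ni nj -> /edge_inj[] E.
    by apply: (chain_uniq tc op cw); rewrite 1?ltnW // -!(face_next_chord (en _)) E.
  have e1 : j = i.+1.
    apply: (chain_uniq tc op cw) => //; first exact: ltnW.
    by rewrite -face_walkS -E face_next_chord.
  have e2 : i = j.+1.
    apply: (chain_uniq tc op cw) => //; first exact: ltnW.
    by rewrite -face_walkS E twinK face_next_chord.
  by have := ltnn i; rewrite {2}e2 e1 ltnW.
have oc i j : j < n -> outer_edge i b -> b = edge (ex j) -> False.
  move=> nj /existsP[d /and4P[_ _ /eqP ft /eqP <-]] /edge_inj[] E.
    by have /and3P[_ _] := chain_chord cw nj; rewrite E ft eqxx.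
  by have /and3P[_] := chain_chord cw nj; rewrite E ft eqxx.
have [/existsP[i oi]|/existsPn no] := boolP [exists i : 'I_n.+1, outer_edge i b].
  rewrite (bigD1 i) //= oi big1 => [|j ji]; last first.
    apply/eqP; rewrite eqb0; apply: contra ji => oj.
    by apply/eqP/val_inj; exact: (uo j i (ltn_ord j) (ltn_ord i) oj oi).
  rewrite big1 // => j _; apply/eqP; rewrite eqb0; apply/negP=> /eqP.
  exact: oc oi.
rewrite big1 ?add0n => [|i _]; last by rewrite (negbTE (no i)).
have [/existsP[i /eqP bi]|/existsPn nb] := boolP [exists i : 'I_n, b == edge (ex i)].
  rewrite (bigD1 i) //= {1}bi eqxx big1 // => j ji; apply/eqP; rewrite eqb0.
  by apply: contra ji => /eqP bj; apply/eqP/val_inj; exact: (uc j i (ltn_ord j) (ltn_ord i) bj bi).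
by rewrite big1 // => i _; rewrite (negbTE (nb i)).
Qed.

Lemma cost_sum F B : cost F B n = \sum_(i < n.+1) F i + \sum_(i < n) B i.
Proof. by rewrite /cost big_ord_recl big_split /= -addnA [_ + \sum_(i < n) B i]addnC. Qed.

(** S is projected to the faces with an exterior edge in S and the chords in S; a rival word yields
    a perfect matching that avoids S. *)
Lemma af_lower x S : monotone col x -> anti_forcing_set (matching_of col x) S ->
  (dp t (word x) n).1 <= #|S|.
Proof.
move=> mx /andP[/subsetP sS /eqP uS].
pose F i := [exists b in S, outer_edge i b].
pose B i := edge (ex i) \in S.
have SM b : b \in S -> b \notin matching_of col x by move/sS; rewrite inE => /andP[].
have pS y : monotone col y -> (forall b, b \in matching_of col y -> b \notin S) ->
    matching_of col y = matching_of col x.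
  move=> my hy; apply/set1P; rewrite -uS inE; apply/perfect_matchingD; split=> //.
  exact: (matching_of_perfect tc op colP my).
have al : allowed t (word x) F B n.
  split=> i ni.
    case/existsP=> b /andP[bS /existsP[d /and4P[a /eqP f /eqP ft /eqP E]]] [ti pi].
    have := SM _ bS; rewrite -E (matching_of_outer tc colP) // f => nx.
    apply: (tight_class ni ti a f ft).
    by move: pi nx; rewrite /word; case: (x _); case: (col _); case: (col _).
  by rewrite -word_chord // => /SM.
apply: leq_trans (proj1 (dp_lower (iffLR (monotoneP x) mx) al) _) _.
  move=> p [v fF fB]; have mp := value_of_monotone v.
  suff E : matching_of col (value_of p) = matching_of col x.
    by move=> i ni; rewrite -(matching_of_inj E ni) word_value_of.
  apply: (pS _ mp) => b bM; apply/negP=> bS.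
  have /edgesP[d a E] : b \in edges G by have := sS _ bS; rewrite inE => /andP[].
  have nb := SM _ bS; move: bM nb bS; rewrite {}E => {b} bM nb bS.
  case: (edge_cases a) => [[i ni E]|[i [d' [ni a' f' ft' E]]]].
    move: bM bS; rewrite E word_chord // /exit_bit !word_value_of ?(ltnW ni) // => bM bS.
    by have := fB i ni bS; rewrite bM.
  have Fi : F i.
    by apply/existsP; exists (edge d); rewrite bS; apply/existsP; exists d'; rewrite a' f' ft' E !eqxx.
  move: bM nb; rewrite E !(matching_of_outer tc colP) // f' value_ofE // (fF i ni Fi) /word.
  by case: (x _); case: (col _); case: (col _).
rewrite cost_sum -sum1_card.
apply: leq_trans (_ : \sum_(b in S)
    (\sum_(i < n.+1) outer_edge i b + \sum_(i < n) (b == edge (ex i))) <= _); last first.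
  by apply: leq_sum => b _; apply: edge_index_le1.
rewrite big_split /= [X in _ <= X + _]exchange_big [X in _ <= _ + X]exchange_big /=.
apply: leq_add; apply: leq_sum => i _.
  rewrite /F; case: existsP => //= -[b /andP[bS ob]].
  by rewrite (bigD1 b) //= ob.
rewrite /B; case bS: (_ \in S) => //.
by rewrite (bigD1 (edge (ex i))) //= eqxx.
Qed.

Lemma af_upper x : monotone col x ->
  exists2 S, anti_forcing_set (matching_of col x) S & #|S| <= (dp t (word x) n).1.
Proof.
move=> mx; have t0 : t 0 <> Tight by rewrite chain_type0.
have [[F [B [al fo <-]]] _] := dp_upper t0 (iffLR (monotoneP x) mx).
(* For a fixed letter, one exterior edge of the unmatched parity. [class_nonempty] supplies it
   wherever F holds, so the default is never taken there. *)
pose od i := odflt (en i) [pick d | [&& dart d, face d == face (en i), face (twin d) == O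
                                     & col d.1 == ~~ x (face (en i))]].
have odP i : i <= n -> F i -> [/\ dart (od i), face (od i) = face (en i), face (twin (od i)) = O
    & col (od i).1 = ~~ x (face (en i))].
  move=> ni Fi; rewrite /od; case: pickP => [d /and4P[a /eqP ? /eqP ? /eqP ?] //|no].
  have [|d [a f ft c]] := @class_nonempty i (~~ x (face (en i))) ni.
    case=> ti xi; case: al => /(_ i ni Fi) h _; apply: h; split=> //.
    by rewrite /word -xi; case: (x _).
  by have := no d; rewrite a f ft c !eqxx.
pose S := [set edge (od i) | i : 'I_n.+1 & F i] :|: [set edge (ex i) | i : 'I_n & B i].
have SM b : b \in S -> b \in edges G :\: matching_of col x.
  rewrite inE => /orP[]/imsetP[i]; rewrite inE => h ->; rewrite inE.
    have [a f ft c] := odP i (ltn_ord i) h; rewrite edges_dart // andbT.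
    by rewrite (matching_of_outer tc colP) // f c; case: (x _).
  rewrite word_chord //; case: al => _ /(_ i (ltn_ord i) h) -> /=.
  by apply: edges_dart; have /and3P[] := chain_chord cw (ltn_ord i).
exists S; last first.
  rewrite cost_sum; apply: leq_trans (leq_card_setU _ _) _; apply: leq_add.
    apply: leq_trans (leq_imset_card _ _) _; rewrite -sum1_card big_mkcond.
    by apply: leq_sum => i _; rewrite inE; case: (F i).
  apply: leq_trans (leq_imset_card _ _) _; rewrite -sum1_card big_mkcond.
  by apply: leq_sum => i _; rewrite inE; case: (B i).
apply/andP; split; first by apply/subsetP=> b /SM.
have pm := matching_of_perfect tc op colP mx.
apply/eqP/setP=> M; rewrite in_set1 inE; apply/idP/eqP=> [/perfect_matchingD[pM hM]|->]; last first.
  by apply/perfect_matchingD; split=> // b bM; apply/negP=> /SM; rewrite inE bM.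
have [y my E] := matching_of_surj tc op colP pM; rewrite {}E in hM *.
apply: matching_of_word; apply: fo; split.
- exact/monotoneP.
- move=> i ni Fi; have [a f ft c] := odP i ni Fi.
  have : edge (od i) \notin matching_of col y.
    apply/negP=> /hM/negP; apply; rewrite inE; apply/orP; left; apply/imsetP.
    by exists (Ordinal (ni : i < n.+1)); rewrite ?inE.
  rewrite (matching_of_outer tc colP) // f c /word.
  by case: (x _); case: (y _); case: (col _).
move=> i ni Bi; rewrite -word_chord //; apply/negP=> /hM/negP; apply.
rewrite inE; apply/orP; right; apply/imsetP.
by exists (Ordinal ni); rewrite ?inE.
Qed.

Lemma af_matching_of x : monotone col x -> af (matching_of col x) = (dp t (word x) n).1.
Proof.
move=> mx; have [[S aS cS] minS] := afP (matching_of_perfect tc op colP mx).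
apply/eqP; rewrite eqn_leq -{2}cS af_lower // andbT.
by have [S' /minS h1 h2] := af_upper mx; apply: leq_trans h1 h2.
Qed.

Lemma spec_af_range k :
  (k \in spec_af G) = (lowest (ends_at t n) <= k <= highest (ends_at t n)).
Proof.
apply/idP/idP=> [/existsP[M /andP[pM /eqP <-]]|].
  have [x mx ->] := matching_of_surj tc op colP pM.
  apply/(spectrum_range _ chain_type0 chain_typen).
  by exists (word x); [apply/monotoneP|rewrite af_matching_of].
case/(spectrum_range _ chain_type0 chain_typen) => p v <-.
have mp := value_of_monotone v.
apply/existsP; exists (matching_of col (value_of p)).
rewrite (matching_of_perfect tc op colP mp) af_matching_of //=; apply/eqP.
by congr fst; apply: eq_dp => i ni; rewrite word_value_of.
Qed.

End Spectrum.

(** * The machine *)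

(* Configurations with a finite list of registers, so that symbolic execution
   computes; [agree] relates them to the states of the machine. *)
Definition config : Type := nat * seq nat * (nat -> nat).

Definition run_instr (i : instr) (c : config) : config :=
  let: (p, R, m) := c in
  match i with
  | Const r k => (p.+1, set_nth 0 R r k, m)
  | Add r a b => (p.+1, set_nth 0 R r (nth 0 R a + nth 0 R b), m)
  | Defs.Sub r a b => (p.+1, set_nth 0 R r (nth 0 R a - nth 0 R b), m)
  | Read r a => (p.+1, set_nth 0 R r (m (nth 0 R a)), m)
  | Write a r => (p.+1, R, fun x => if x == nth 0 R a then nth 0 R r else m x)
  | Jz r l => (if nth 0 R r == 0 then l else p.+1, R, m)
  end.

Definition agree (s : state) (c : config) : Prop :=
  [/\ pc s = c.1.1, reg s =1 nth 0 c.1.2 & Defs.mem s =1 c.2].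

Definition bounded (W : nat) (c : config) : Prop :=
  (forall i, nth 0 c.1.2 i <= W) /\ (forall a, c.2 a <= W).

(** Only constants and sums can exceed the word bound; the other instructions copy or decrease. *)
Definition safe (W : nat) (i : instr) (c : config) : Prop :=
  match i with
  | Const _ k => k <= W
  | Add _ a b => nth 0 c.1.2 a + nth 0 c.1.2 b <= W
  | _ => True
  end.

Lemma agree_exec i s c : agree s c -> agree (exec i s) (run_instr i c).
Proof.
case: s c => [p R m] [[p' R'] m'] [/= -> eR em].
have upd r v v' : v = v' -> [eta R with r |-> v] =1 nth 0 (set_nth 0 R' r v').
  by move=> -> j; rewrite nth_set_nth /= eR.
case: i => [r k|r a b|r a b|r a|a r|r l]; split=> //=; try by apply: upd; rewrite ?eR ?em.
  by move=> j; rewrite /= !eR em.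
by rewrite eR.
Qed.

Lemma bounded_exec W i c : bounded W c -> safe W i c -> bounded W (run_instr i c).
Proof.
case: c => [[p R] m] [/= bR bm]; case: i => [r k|r a b|r a b|r a|a r|r l] /= h; split=> //= j;
  rewrite ?nth_set_nth /=; case: eqP => // _.
exact: leq_trans (leq_subr _ _) _.
Qed.

(** A Hoare triple for total correctness with a time budget and a word bound; [reach_bind] is its
    sequencing rule. *)
Definition reach (P : program) (W : nat) (c : config) (T : nat) (Q : config -> Prop) : Prop :=
  forall s, agree s c -> bounded W c -> exists t c',
    [/\ t <= T, agree (iter t (step P) s) c',
        forall u, u <= t -> words_le W (iter u (step P) s), bounded W c' & Q c'].

Lemma agree_words W s c : agree s c -> bounded W c -> words_le W s.
Proof. by case=> _ eR em [bR bm] i; rewrite eR em. Qed.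

Lemma reach_done P W c T (Q : config -> Prop) : Q c -> reach P W c T Q.
Proof.
move=> q s ag bd; exists 0, c; split=> // u; rewrite leqn0 => /eqP->.
exact: agree_words ag bd.
Qed.

Lemma reach_step P W c T Q i : onth P c.1.1 = Some i ->
    (bounded W c -> safe W i c) -> reach P W (run_instr i c) T Q -> reach P W c T.+1 Q.
Proof.
move=> Pi sf r s ag bd; have [epc _ _] := ag.
have e : step P s = exec i s by rewrite /step epc Pi.
have ag' := agree_exec i ag; have bd' := bounded_exec bd (sf bd).
have [t [c' [tT agt w bt q]]] := r _ ag' bd'.
exists t.+1, c'; rewrite iterSr e; split=> // -[|u] ut; first exact: agree_words ag bd.
by rewrite iterSr e; apply: w.
Qed.

Lemma reach_bind P W c T1 T2 (Q1 Q2 : config -> Prop) :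
  reach P W c T1 Q1 -> (forall c', Q1 c' -> reach P W c' T2 Q2) -> reach P W c (T1 + T2) Q2.
Proof.
move=> r1 r2 s ag bd; have [t1 [c1 [tT1 ag1 w1 b1 q1]]] := r1 s ag bd.
have [t2 [c2 [tT2 ag2 w2 b2 q2]]] := r2 _ q1 _ ag1 b1.
exists (t2 + t1), c2; rewrite iterD; split=> //; first by rewrite addnC leq_add.
move=> u ut; have [ut1|/ltnW t1u] := leqP u t1; first exact: w1.
by rewrite -(subnK t1u) iterD; apply: w2; rewrite leq_subLR addnC.
Qed.

Lemma reach_le P W c T T' Q : T <= T' -> reach P W c T Q -> reach P W c T' Q.
Proof.
move=> le r s ag bd; have [t [c' [tT h1 h2 h3 h4]]] := r s ag bd.
by exists t, c'; split=> //; apply: leq_trans tT le.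
Qed.

Lemma reach_computes P W inp out T k :
  bounded W (0, nseq k 0, nth 0 inp) ->
  reach P W (0, nseq k 0, nth 0 inp) T (fun c =>
    [/\ size P <= c.1.1, nth 0 c.1.2 0 = size out
      & forall i, i < size out -> c.2 (nth 0 c.1.2 1 + i) = nth 0 out i]) ->
  computes_within P T W inp out.
Proof.
move=> bd r; have [|t [c [tT [epc eR em] w _ [h0 h1 h2]]]] := r (init inp) _ bd.
  by split=> //= i; rewrite nth_nseq; case: ifP.
exists t; split=> //; first by rewrite /halted epc.
by split=> [|i io]; rewrite ?eR ?em; [|apply: h2].
Qed.

(** The base address is a parameter as the code is used twice. Register 0 stays 0, so [Jz 0 l] is a
    plain jump; equality is tested by (a - b) + (b - a) = 0. *)
Definition walk_code (b : nat) : program :=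
  [:: Add 6 5 0; Const 8 0;
      Add 7 3 6; Read 6 7; Defs.Sub 8 1 8; Defs.Sub 7 5 6; Defs.Sub 9 6 5; Add 7 7 9; Jz 7 (b + 13);
      Add 7 4 6; Read 7 7; Jz 7 (b + 13); Jz 0 (b + 2)].

(* Registers 0 and 1 hold 0 and 1; 2, 3, 4 the addresses of the arrays of twins
   and successors and of the marks; 5 and 6 the entry dart and the current dart
   of the face; 8 the parity of their distance; 10 to 16 the seven [ends].  The
   numbers in the comments are addresses, for the targets of the jumps; minima
   and maxima are computed as a - (a - b) and a + (b - a). *)
Definition chain_code : program :=
  [:: Const 1 1; Const 7 2; Read 17 7; Read 9 1; Const 7 3; Add 2 7 9; Add 3 2 9;
      Add 4 3 9; Add 5 17 0;
      (* 9: mark the twins of the outer darts *)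
      Add 7 2 5; Read 7 7; Add 7 4 7; Write 7 1; Add 7 3 5; Read 5 7;
      Defs.Sub 7 5 17; Defs.Sub 9 17 5; Add 7 7 9; Jz 7 20; Jz 0 9;
      Add 7 2 17; Read 5 7]
  (* 22: walk to an end of the chain *)
  ++ walk_code 22 ++
  [:: Defs.Sub 7 5 6; Defs.Sub 9 6 5; Add 7 7 9; Jz 7 42; Add 7 2 6; Read 5 7; Jz 0 22;
      (* 42 *)
      Const 10 1; Const 11 0; Const 12 1; Const 13 1; Const 14 1; Const 15 1; Const 16 2;
      Add 7 4 5; Read 7 7; Jz 7 53; Jz 0 139;
      (* 53: enter the next face *)
      Add 7 2 6; Read 5 7]
  ++ walk_code 55 ++
  [:: Jz 8 87;
      (* 69: Mono *)
      Add 7 10 1; Add 9 12 1; Defs.Sub 18 7 9; Defs.Sub 9 7 18; Defs.Sub 18 16 9; Defs.Sub 9 16 18;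
      Defs.Sub 18 14 9; Defs.Sub 14 14 18; Defs.Sub 18 7 12; Defs.Sub 12 7 18; Add 10 12 0; Add 16 12 1;
      Add 7 11 1; Add 15 13 1; Defs.Sub 18 7 13; Add 13 13 18; Const 11 0; Jz 0 134;
      (* 87: test for Tight *)
      Add 7 3 5; Read 7 7; Add 7 3 7; Read 7 7; Defs.Sub 9 7 6; Defs.Sub 18 6 7; Add 9 9 18;
      Add 7 3 6; Read 7 7; Add 7 3 7; Read 7 7; Defs.Sub 18 7 5; Add 9 9 18; Defs.Sub 18 5 7;
      Add 9 9 18; Jz 9 120;
      (* 103: Turn *)
      Add 7 10 1; Add 9 12 1; Defs.Sub 18 7 9; Defs.Sub 9 7 18; Defs.Sub 18 16 9; Defs.Sub 9 16 18;
      Add 10 14 0; Defs.Sub 18 7 12; Defs.Sub 14 7 18; Add 12 9 0; Add 16 9 1; Add 7 11 1;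
      Add 11 15 0; Defs.Sub 18 7 13; Add 15 13 18; Add 13 13 1; Jz 0 134;
      (* 120: Tight *)
      Add 7 10 1; Add 17 12 1; Defs.Sub 18 7 17; Defs.Sub 9 7 18; Defs.Sub 18 16 9; Defs.Sub 9 16 18;
      Add 10 14 0; Add 14 7 0; Add 12 9 0; Add 16 17 0; Add 7 11 1; Add 11 15 0;
      Add 15 7 0; Add 13 13 1;
      (* 134 *)
      Defs.Sub 7 5 6; Defs.Sub 9 6 5; Add 7 7 9; Jz 7 139; Jz 0 53;
      (* 139: output *)
      Defs.Sub 18 12 14; Defs.Sub 12 12 18; Defs.Sub 18 10 12; Defs.Sub 10 10 18; Defs.Sub 18 15 13;
      Add 13 13 18; Add 13 13 1; Defs.Sub 5 13 10; Const 6 0;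
      Defs.Sub 7 5 6; Jz 7 154; Write 6 10; Add 10 10 1; Add 6 6 1; Jz 0 148;
      Add 0 5 0; Const 1 0].

Lemma distance_eq0 a b : (a - b + (b - a) == 0) = (a == b).
Proof. by rewrite addn_eq0 !subn_eq0 -eqn_leq. Qed.

Ltac exec_step := apply: reach_step;
  [reflexivity | move=> _; cbn [safe fst snd nth]; first [exact I | lia] |
   cbn [run_instr set_nth nth]].

Lemma exec_Jz P W p R m r l T Q : onth P p = Some (Jz r l) ->
  reach P W (if nth 0 R r == 0 then l else p.+1, R, m) T Q -> reach P W (p, R, m) T.+1 Q.
Proof. by move=> e; apply: (@reach_step P W (p, R, m) T Q _ e). Qed.

(** Six instructions per number, written from address 0 over the input; the final 4 are the last
    test and the two result registers. *)
Lemma output_loop W lo cnt r2 r3 r4 r8 r9 r11 r12 r13 r14 r15 r16 r17 r18 k j r7 M :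
  j + k = cnt -> lo + cnt <= W -> 0 < lo -> (forall i, i < j -> M i = lo + i) ->
  reach chain_code W (148, [:: 0; 1; r2; r3; r4; cnt; j; r7; r8; r9; lo + j;
      r11; r12; r13; r14; r15; r16; r17; r18], M)
    (6 * k + 4) (fun c =>
    [/\ size chain_code <= c.1.1, nth 0 c.1.2 0 = cnt
      & forall i, i < cnt -> c.2 (nth 0 c.1.2 1 + i) = lo + i]).
Proof.
elim: k j r7 M => [|k IH] j r7 M jk bW lo0 Mi.
  rewrite -[6 * 0 + 4]/4; exec_step; apply: exec_Jz; first reflexivity.
  cbn [nth]; have -> : cnt - j == 0 by rewrite -jk addn0 subnn.
  do 2 exec_step; apply: reach_done; split=> //=; first by rewrite addn0.
  by move=> i; rewrite -jk addn0 => /Mi.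
have -> : 6 * k.+1 + 4 = (6 * k + 4).+4.+2 by lia.
exec_step; apply: exec_Jz; first reflexivity.
cbn [nth]; have -> : (cnt - j == 0) = false by lia.
do 3 exec_step; apply: exec_Jz; first reflexivity.
rewrite /= -[lo + j + 1]addnA addn1; apply: IH => //; first by rewrite -jk addSnnS.
move=> i; rewrite ltnS leq_eqVlt => /predU1P[->|ij]; first by rewrite eqxx.
by rewrite (ltn_eqF ij) Mi.
Qed.

Lemma output_run W lA hA lB hB lD hD lE d e a7 a8 a9 a17 a18 tw nx mk M :
  let lo := minn lA (minn lB lD) in let hi := maxn hB hD in
  hi.+1 + lo <= W -> 0 < lo ->
  reach chain_code W (139, [:: 0; 1; tw; nx; mk; d; e; a7; a8; a9;
      lA; hA; lB; hB; lD; hD; lE; a17; a18], M)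
    (6 * (hi.+1 - lo) + 13) (fun c =>
    [/\ size chain_code <= c.1.1, nth 0 c.1.2 0 = hi.+1 - lo
      & forall i, i < hi.+1 - lo -> c.2 (nth 0 c.1.2 1 + i) = lo + i]).
Proof.
move=> lo hi bW lo0; have -> : 6 * (hi.+1 - lo) + 13 = (6 * (hi.+1 - lo) + 4).+4.+4.+1 by lia.
do 9 exec_step.
have -> : lA - (lA - (lB - (lB - lD))) = lo + 0 by rewrite /lo; lia.
have -> : hB + (hD - hB) + 1 = hi.+1 by rewrite /hi; lia.
have -> : hi.+1 - (lo + 0) = hi.+1 - lo by rewrite addn0.
by apply: output_loop; lia.
Qed.

Lemma congr_cons (T : Type) (x y : T) s t : x = y -> s = t -> x :: s = y :: t.
Proof. by move=> -> ->. Qed.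

Ltac regs_eq := repeat (apply: congr_cons; first (first [reflexivity | lia])); reflexivity.

(** * Execution of the program on a doubly connected edge list *)

Section Run.
Variable G : plane_graph.
Local Notation V := (vert G).
Local Notation O := (outer_face G).
Implicit Types (d x : V * V).
Variable ds : seq (V * V).
Hypothesis dsP : dart_numbering ds.
Variable W : nat.
Local Notation m := (size ds).
Hypothesis mW : 8 * m + 8 <= W.
Local Notation idx d := (index d ds).
Local Notation o := (outer_dart G).

Lemma idx_lt d : dart d -> idx d < m.
Proof. by case: dsP => _ E a; rewrite index_mem E. Qed.

Lemma idx_eq d x : dart d -> dart x -> (idx d == idx x) = (d == x).
Proof.
case: dsP => _ E a a'; apply/eqP/eqP => [e|-> //].
by rewrite -[d](nth_index d (s := ds)) ?E // e nth_index ?E.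
Qed.

Lemma card_darts_size : #|[set d | @dart G d]| = m.
Proof.
case: dsP => u E; rewrite -(card_uniqP u); apply: eq_card => d.
by rewrite inE E.
Qed.

Definition dcel_ok (M : nat -> nat) : Prop :=
  (forall d, dart d -> M (3 + m + idx d) = idx (twin d)) /\
  (forall d, dart d -> M (3 + m + m + idx d) = idx (dnext d)).

Definition marks_ok (M : nat -> nat) : Prop :=
  forall d, dart d -> M (3 + m + m + m + idx d) = (face (twin d) == O).

(** The loop has 11 instructions. On an inner face a mark 0 means a chord. The two base addresses
    are kept concrete so that fetching an instruction computes. *)
Lemma walk_loop b d M r10 r11 r12 r13 r14 r15 r16 r17 r18 k j a7 a9 :
  b = 22 \/ b = 55 -> dcel_ok M -> marks_ok M -> dart d -> face d != O ->
  j + k.+1 = run d ->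
  reach chain_code W (b + 2, [:: 0; 1; 3 + m; 3 + m + m; 3 + m + m + m; idx d;
      idx (iter j (@dnext G) d); a7; nat_of_bool (odd j); a9;
      r10; r11; r12; r13; r14; r15; r16; r17; r18], M)
    (11 * k.+1) (fun c => exists a, c = (b + 13, [:: 0; 1; 3 + m; 3 + m + m; 3 + m + m + m; idx d;
      idx (next_chord d); 0; nat_of_bool (odd (run d)); a;
      r10; r11; r12; r13; r14; r15; r16; r17; r18], M)).
Proof.
move=> bE [_ Mn] Mm a f; elim: k j a7 a9 => [|k IH] j a7 a9 jk.
all: have aj : dart (iter j (@dnext G) d) by rewrite dart_iter.
all: set x := iter j.+1 (@dnext G) d; have ax : dart x by rewrite dart_iter.
all: have l1 := idx_lt a; have l2 := idx_lt ax; have l3 := idx_lt aj.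
all: have oE : 1 - odd j = odd j.+1 by rewrite /=; case: (odd j).
all: have Mx := Mm x ax; have Mj := Mn _ aj; rewrite -[dnext (iter j _ d)]/x in Mj.
  have xE : next_chord d = x by rewrite /next_chord -jk addn1.
  rewrite xE -jk addn1; case: bE => ->; rewrite -[11 * 1]/11.
  1,2: do 2 exec_step; rewrite Mj; do 4 exec_step; rewrite oE.
  1,2: apply: exec_Jz; first reflexivity.
  1,2: cbn [nth]; rewrite distance_eq0 idx_eq //.
  1,2: have [e|ne] := eqVneq d x; first by
    apply: reach_done; eexists; congr (_, _, _); rewrite -e subnn.
  1,2: do 2 exec_step; rewrite Mx.
  1,2: have /and3P[_ _ /negbTE->] : chord x by
    case: (next_chordP d); rewrite xE // => h; rewrite h eqxx in ne.
  1,2: apply: exec_Jz; first reflexivity.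
  1,2: by cbn [nth nat_of_bool eq_op]; apply: reach_done; eexists.
have [|xd nc] := @run_lt _ d j.+1; first by rewrite -jk; lia.
have -> : 11 * k.+2 = (11 * k.+1).+4.+4.+3 by lia.
case: bE IH => -> IH.
1,2: do 2 exec_step; rewrite Mj; do 4 exec_step; rewrite oE.
1,2: apply: exec_Jz; first reflexivity.
1,2: cbn [nth]; rewrite distance_eq0 idx_eq // eq_sym (negbTE xd).
1,2: do 2 exec_step; rewrite Mx.
1,2: have -> : face (twin x) == O by
  apply: contraR nc => h; rewrite /chord ax face_iter f h.
1,2: apply: exec_Jz; first reflexivity.
1,2: cbn [nth nat_of_bool eq_op]; apply: exec_Jz; first reflexivity.
1,2: by apply: IH; rewrite -jk addSnnS.
Qed.

Lemma walk_run b d e M r10 r11 r12 r13 r14 r15 r16 r17 r18 a7 a8 a9 :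
  b = 22 \/ b = 55 -> dcel_ok M -> marks_ok M -> dart d -> face d != O ->
  reach chain_code W (b, [:: 0; 1; 3 + m; 3 + m + m; 3 + m + m + m; idx d;
      e; a7; a8; a9; r10; r11; r12; r13; r14; r15; r16; r17; r18], M)
    (11 * run d + 2) (fun c => exists a, c = (b + 13, [:: 0; 1; 3 + m; 3 + m + m; 3 + m + m + m; idx d;
      idx (next_chord d); 0; nat_of_bool (odd (run d)); a;
      r10; r11; r12; r13; r14; r15; r16; r17; r18], M)).
Proof.
move=> bE Mo Mm a f; have l1 := idx_lt a; rewrite addn2.
have := @walk_loop b d M r10 r11 r12 r13 r14 r15 r16 r17 r18 (run d).-1 0 a7 a9 bE Mo Mm a f.
rewrite prednK ?run_gt0 // => /(_ erefl).
by case: bE => -> H; do 2 exec_step; rewrite addn0.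
Qed.

Lemma dart_o : dart o.
Proof. exact: outer_dartP. Qed.

(** Invariant: exactly the twins of the first j darts of the outer walk are marked. The marks lie
    behind the input arrays, which are preserved. *)
Lemma mark_loop M k j a7 a9 :
  dcel_ok M -> j + k.+1 = fingraph.order (@dnext G) o ->
  (forall d, dart d -> M (3 + m + m + m + idx d) =
     has (fun i => d == twin (iter i (@dnext G) o)) (iota 0 j)) ->
  reach chain_code W (9, [:: 0; 1; 3 + m; 3 + m + m; 3 + m + m + m; idx (iter j (@dnext G) o);
      0; a7; 0; a9; 0; 0; 0; 0; 0; 0; 0; idx o; 0], M)
    (11 * k.+1) (fun c => exists a7 a9 M', [/\ dcel_ok M', marks_ok M' &
      c = (20, [:: 0; 1; 3 + m; 3 + m + m; 3 + m + m + m; idx o;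
      0; a7; 0; a9; 0; 0; 0; 0; 0; 0; 0; idx o; 0], M')]).
Proof.
elim: k j a7 a9 M => [|k IH] j a7 a9 M Mo jk Mj.
all: have aj : dart (iter j (@dnext G) o) by rewrite dart_iter dart_o.
all: set x := iter j.+1 (@dnext G) o; have ax : dart x by rewrite dart_iter dart_o.
all: have at_ : dart (twin (iter j (@dnext G) o)) by rewrite dart_twin.
all: have l1 := idx_lt aj; have l2 := idx_lt ax; have l3 := idx_lt at_.
all: have l4 := idx_lt dart_o.
all: have [Mt Mn] := Mo.
all: pose M' a := if a == 3 + m + m + m + idx (twin (iter j (@dnext G) o)) then 1 else M a.
all: have Mo' : dcel_ok M' by
  split=> d a; rewrite /M' ?Mt ?Mn //; case: eqP => //; have := idx_lt a; lia.
all: have Mj' d : dart d -> M' (3 + m + m + m + idx d) =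
     has (fun i => d == twin (iter i (@dnext G) o)) (iota 0 j.+1) by
  move=> a; rewrite -[j.+1]addn1 iotaD has_cat /= orbF /M' eqn_add2l idx_eq // Mj // orbC; case: eqP.
all: have Mnj : M' (3 + m + m + idx (iter j (@dnext G) o)) = idx x by have [_ ->] := Mo'.

1,2: have E11 i : 11 * i.+1 = (11 * i).+4.+4.+3 by lia.
1,2: rewrite E11.
1,2: do 2 exec_step; rewrite Mt //; do 2 exec_step; rewrite -/(M').
1,2: do 2 exec_step; rewrite Mnj; do 3 exec_step.
1,2: apply: exec_Jz; first reflexivity.
1,2: cbn [nth]; rewrite distance_eq0 idx_eq // ?dart_o //.
  have xo : x = o by rewrite /x -[j.+1]addn1 jk iter_order_dnext.
  rewrite xo eqxx; apply: reach_done; eexists _, _, M'; split; [exact: Mo'| |reflexivity].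
  move=> d a; rewrite Mj' // -[j.+1]addn1 jk; congr nat_of_bool.
  apply/hasP/eqP => [[i _ /eqP ->]|f]; first by rewrite twinK face_iter.
  have /next_chord_mem[i io E] : twin d \in face o by apply/faceP; rewrite f.
  by exists i; rewrite ?mem_iota -?card_face // -E twinK.
have -> : (x == o) = false by apply/negbTE/iter_dnext_neq; rewrite card_face -jk; lia.
by do 1 exec_step; apply: IH; rewrite // -jk addSnnS.
Qed.

Lemma marking_run M : dcel_ok M -> M 1 = m -> M 2 = idx o ->
  (forall d, dart d -> M (3 + m + m + m + idx d) = 0) ->
  reach chain_code W (0, nseq 19 0, M) (11 * m + 11) (fun c => exists a7 a9 M',
    [/\ dcel_ok M', marks_ok M' & c = (22, [:: 0; 1; 3 + m; 3 + m + m; 3 + m + m + m;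
      idx (twin o); 0; a7; 0; a9; 0; 0; 0; 0; 0; 0; 0; idx o; 0], M')]).
Proof.
move=> Mo M1 M2 Mz; have l4 := idx_lt dart_o.
have om : fingraph.order (@dnext G) o <= m.
  rewrite -card_darts_size // -card_face; apply/subset_leq_card/subsetP => d df.
  by rewrite inE (dart_face_mem df) dart_o.
apply: (@reach_le _ _ _ ((11 * fingraph.order (@dnext G) o + 2).+4.+4.+1)); first by lia.
cbn [nseq ncons iter]; do 3 exec_step; rewrite M2; exec_step; rewrite M1; do 5 exec_step; rewrite addn0.
have := fingraph.order_gt0 (@dnext G) o; case E: (fingraph.order _ o) => [//|k] _.
apply: reach_bind; first by apply: (@mark_loop M k 0) => // d /Mz.
move=> _ [a7 [a9 [M' [Mo' Mm ->]]]]; exec_step; exec_step.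
have [Mt _] := Mo'; rewrite Mt ?dart_o //.
by apply: reach_done; exists (3 + m + idx o), a9, M'.
Qed.

Section Chain.
Hypothesis epc : even_polygonal_chain G.

Lemma search_run d n M : dcel_ok M -> marks_ok M -> dart d -> face d != O ->
    (forall i, i < n -> next_chord (walk d i) != walk d i) ->
    next_chord (walk d n) = walk d n ->
  forall k i e a7 a8 a9 a17 a18, i + k = n ->
  reach chain_code W (22, [:: 0; 1; 3 + m; 3 + m + m; 3 + m + m + m;
      idx (walk d i); e; a7; a8; a9; 0; 0; 0; 0; 0; 0; 0; a17; a18], M)
    (\sum_(i <= l < n.+1) (11 * run (walk d l) + 9))
    (fun c => exists a7 a8 a9, c = (42, [:: 0; 1; 3 + m; 3 + m + m; 3 + m + m + m;
      idx (walk d n); idx (walk d n); a7; a8; a9; 0; 0; 0; 0; 0; 0; 0; a17; a18], M)).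
Proof.
move=> Mo Mm a f nb en; have cn i : i < n -> chord (next_chord (walk d i)).
  by move=> ni; case: (next_chordP (walk d i)) => // h; have := nb i ni; rewrite h eqxx.
have inn i : i <= n -> dart (walk d i) /\ face (walk d i) != O by apply: walk_inner.
elim=> [|k IH] i e a7 a8 a9 a17 a18 ik.
all: have ni : i <= n by lia.
all: have [ai fi] := inn i ni; have an : dart (next_chord (walk d i)) by rewrite dart_next_chord.
all: have l1 := idx_lt ai; have l2 := idx_lt an.
all: rewrite big_ltn //; set T := \sum_(_ <= _ < _) _.
all: apply: (@reach_le _ _ _ ((11 * run (walk d i) + 2) + (T + 1).+4.+2)); first by lia.
all: apply: reach_bind; first by apply: walk_run => //; left.
all: move=> _ [z ->]; do 3 exec_step; apply: exec_Jz; first reflexivity.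
all: cbn [nth]; rewrite distance_eq0 idx_eq //.
  rewrite addn0 in ik; rewrite ik in ai fi l1 l2 *.
  by rewrite en eqxx; apply: reach_done; eexists _, _, _.
rewrite eq_sym (negbTE (nb i _)); last by lia.
have [Mt _] := Mo.
do 2 exec_step; rewrite Mt // -walkS addn1; exec_step.
by apply: IH; rewrite -ik addSnnS.
Qed.

(** A test in constant time, whatever the length of the face: two double steps that exchange entry
    and exit close the face after four darts, and in a square an even run short of the full turn is
    2. *)
Lemma tight_test (col : V -> bool) d :
  (forall u v : V, adj u v -> col u != col v) -> dart d -> face d != O ->
  ~~ odd (run d) ->
  (dnext (dnext d) == next_chord d) && (dnext (dnext (next_chord d)) == d)
    = (next_chord d != d) && (#|face d| == 4).
Proof.
move=> colP a f er; case: epc => _ _ op _.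
have ge4 := inner_face_ge4 op colP a f.
apply/andP/andP => [[/eqP e1 /eqP e2]|[ne /eqP f4]].
  have d4 : iter 4 (@dnext G) d = d by rewrite /= e1.
  split; first by rewrite -e1; apply: (@iter_dnext_neq _ d 2); apply: ltnW.
  rewrite eqn_leq ge4 andbT leqNgt; apply/negP=> h.
  by have := @iter_dnext_neq _ d 4 h; rewrite d4 eqxx.
have d4 : iter 4 (@dnext G) d = d by rewrite -f4 card_face iter_order_dnext.
have r2 : run d = 2.
  have := run_gt0 d; have := run_le d; rewrite f4.
  have : run d != 4 by apply: contraNneq ne => r4; rewrite /next_chord r4 d4.
  by case: (run _) er => [|[|[|[|[]]]]].
by rewrite /next_chord r2 /=; split=> //; apply/eqP.
Qed.

(** 34 is the length of the branch [Turn], the longest: the jump on the parity, 16 instructions of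
    the [Tight] test and 17 of the update. *)
Lemma update_run (col : V -> bool) d M lA hA lB hB lD hD lE a7 a9 a17 a18 :
  (forall u v : V, adj u v -> col u != col v) -> dcel_ok M -> dart d -> face d != O ->
  [&& lA <= m + 1, lB <= m + 1, lD <= m + 1 & lE <= m + 1] ->
  [&& hA <= m + 1, hB <= m + 1 & hD <= m + 1] ->
  reach chain_code W (68, [:: 0; 1; 3 + m; 3 + m + m; 3 + m + m + m; idx d; idx (next_chord d);
      a7; nat_of_bool (odd (run d)); a9; lA; hA; lB; hB; lD; hD; lE; a17; a18], M) 34
    (fun c => exists a7 a8 a9 a17 a18,
      let: Ends lA hA lB hB lD hD lE := next_ends (chain_type d 0) (Ends lA hA lB hB lD hD lE) in
      c = (134, [:: 0; 1; 3 + m; 3 + m + m; 3 + m + m + m; idx d; idx (next_chord d);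
      a7; a8; a9; lA; hA; lB; hB; lD; hD; lE; a17; a18], M)).
Proof.
move=> colP [_ Mn] a f lW hW.
have an : dart (next_chord d) by rewrite dart_next_chord.
have l1 := idx_lt a; have l2 := idx_lt an.
have T := tight_test colP a f.
rewrite /chain_type -[walk d 0]/d.
case: (odd (run d)) T => [_|/(_ isT) T]; (apply: exec_Jz; first reflexivity); cbn [nth nat_of_bool eq_op].
  do 17 exec_step; apply: exec_Jz; first reflexivity.
  cbn [nth]; apply: reach_done; eexists _, _, _, _, _; cbn [next_ends].
  congr (_, _, _); regs_eq.
have Mnn x : dart x -> M (3 + m + m + M (3 + m + m + idx x)) = idx (dnext (dnext x)).
  by move=> ax; rewrite !Mn ?dart_dnext.
have l3 : idx (dnext (dnext d)) < m by rewrite idx_lt ?dart_dnext.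
have l4 : idx (dnext (dnext (next_chord d))) < m by rewrite idx_lt ?dart_dnext.
have l5 : idx (dnext d) < m by rewrite idx_lt ?dart_dnext.
have l6 : idx (dnext (next_chord d)) < m by rewrite idx_lt ?dart_dnext.
do 2 exec_step; rewrite Mn //; do 2 exec_step; rewrite Mn ?dart_dnext //.
do 5 exec_step; rewrite Mn //; do 2 exec_step; rewrite Mn ?dart_dnext //.
do 4 exec_step; apply: exec_Jz; first reflexivity.
cbn [nth]; rewrite -addnA addn_eq0 !distance_eq0 !idx_eq ?dart_dnext // T.
case: ifP => _.
  do 14 exec_step; apply: reach_done; eexists _, _, _, _, _; cbn [next_ends].
  congr (_, _, _); regs_eq.
do 16 exec_step; apply: exec_Jz; first reflexivity.
cbn [nth]; apply: reach_done; eexists _, _, _, _, _; cbn [next_ends].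
congr (_, _, _); regs_eq.
Qed.
Lemma walk_faces d n : dart d -> face d != O ->
    (forall i, 0 < i < n -> next_chord (walk d i) != walk d i) ->
    (0 < n -> chord (next_chord d)) ->
  \sum_(0 <= l < n.+1) #|face (walk d l)| <= m.
Proof.
have [tc _ op _] := epc => a f nb c0.
rewrite big_mkord -card_darts_size; apply: walk_sum => // -[|i] ni; first exact: c0.
by case: (next_chordP (walk d i.+1)) => // h; have := nb i.+1 ni; rewrite h eqxx.
Qed.

(** Every face has a dart to which its constant overhead c can be charged. *)
Lemma sum_time (F : nat -> nat) c (k : V * V) n : (forall l, F l <= #|face (walk k l)|) ->
  \sum_(0 <= l < n.+1) #|face (walk k l)| <= m ->
  \sum_(0 <= l < n.+1) (11 * F l + c) <= (11 + c) * m.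
Proof.
move=> Fl sm; apply: leq_trans (_ : (11 + c) * \sum_(0 <= l < n.+1) #|face (walk k l)| <= _); last first.
  by rewrite leq_mul2l sm orbT.
rewrite big_distrr /=; apply: leq_sum => l _.
rewrite mulnDl leq_add ?leq_mul2l ?Fl //.
by rewrite leq_pmulr // card_face fingraph.order_gt0.
Qed.

Section ChainRun.
Variables (e : V * V) (n : nat).
Hypothesis cw : chain_walk e n.

Lemma chain_faces : \sum_(0 <= l < n.+1) #|face (walk e l)| <= m.
Proof.
case: (cw) => a f ne ce [nb _]; apply: walk_faces => //.
by rewrite ne -ce.
Qed.

Lemma chain_length : n < m.
Proof.
apply: leq_trans chain_faces.
have : \sum_(0 <= l < n.+1) 1 <= \sum_(0 <= l < n.+1) #|face (walk e l)|.
  by apply: leq_sum => l _; rewrite card_face fingraph.order_gt0.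
by rewrite sum_nat_const_nat subn0 muln1.
Qed.

(** 43 is 2 for entering the face, 2 for starting the walk, 34 for the update and 5 for the closing
    test. *)
Lemma chain_run (col : V -> bool) M :
  (forall u v : V, adj u v -> col u != col v) -> dcel_ok M -> marks_ok M ->
  forall k i r5 a7 a8 a9 a17 a18, i + k.+1 = n ->
  let: Ends lA hA lB hB lD hD lE := ends_at (chain_type e) i in
  reach chain_code W (53, [:: 0; 1; 3 + m; 3 + m + m; 3 + m + m + m; r5; idx (next_chord (walk e i));
      a7; a8; a9; lA; hA; lB; hB; lD; hD; lE; a17; a18], M)
    (\sum_(i.+1 <= l < n.+1) (11 * run (walk e l) + 43))
    (fun c => exists r5 r6 a7 a8 a9 a17 a18,
      let: Ends lA hA lB hB lD hD lE := ends_at (chain_type e) n in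
      c = (139, [:: 0; 1; 3 + m; 3 + m + m; 3 + m + m + m; r5; r6;
      a7; a8; a9; lA; hA; lB; hB; lD; hD; lE; a17; a18], M)).
Proof.
move=> colP Mo Mm; have Lm := chain_length; have [Mt _] := Mo.
elim=> [|k IH] i r5 a7 a8 a9 a17 a18 ik.
all: have ni : i.+1 <= n by lia.
all: have [ai fi] := chain_inner cw ni; have [a0 _] := chain_inner cw (ltnW ni).
all: have an : dart (next_chord (walk e i)) by rewrite dart_next_chord.
all: have an' : dart (next_chord (walk e i.+1)) by rewrite dart_next_chord.
all: have l1 := idx_lt ai; have l2 := idx_lt an; have l3 := idx_lt an'.
all: have := ends_at_le (chain_type e) i; case E: (ends_at (chain_type e) i) => [lA hA lB hB lD hD lE] /=.
all: move=> [[b1 b2 b3 b4] [b5 b6 b7]].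
all: rewrite big_ltn ?ltnS //; set T := \sum_(_ <= _ < _) _.
all: apply: (@reach_le _ _ _ (((11 * run (walk e i.+1) + 2) + (34 + (T + 1).+4)).+2)); first by lia.
all: do 2 exec_step; rewrite Mt //.
all: apply: reach_bind; first by apply: walk_run => //; right.
all: move=> _ [z ->]; apply: reach_bind; first by
  apply: (update_run colP Mo ai fi); lia.
all: have EE : next_ends (chain_type (walk e i.+1) 0) (Ends lA hA lB hB lD hD lE)
       = ends_at (chain_type e) i.+1 by rewrite /= E.
all: rewrite EE; move=> c [a7' [a8' [a9' [a17' [a18' ]]]]].
  rewrite addn1 in ik; rewrite -ik.
  case: (ends_at _ _) => [lA' hA' lB' hB' lD' hD' lE'] ->.
  do 3 exec_step; apply: exec_Jz; first reflexivity.
  cbn [nth]; rewrite distance_eq0 idx_eq //.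
  have -> : next_chord (walk e i.+1) = walk e i.+1 by rewrite ik; case: cw => _ _ _ _ [].
  by rewrite eqxx; apply: reach_done; eexists _, _, _, _, _, _, _.
have ne : (next_chord (walk e i.+1) == walk e i.+1) = false.
  by apply/negbTE; case: cw => _ _ _ _ [nb _]; apply: nb; lia.
have := IH i.+1 (idx (walk e i.+1)); case: (ends_at _ i.+1) => [lA' hA' lB' hB' lD' hD' lE'] IH' ->.
do 3 exec_step; apply: exec_Jz; first reflexivity.
cbn [nth]; rewrite distance_eq0 idx_eq // eq_sym ne addn1; exec_step.
by apply: IH'; rewrite -ik addSnnS.
Qed.

End ChainRun.
End Chain.
End Run.

Lemma size_dcel (G : plane_graph) (ds : seq (vert G * vert G)) :
  size (dcel ds) = 3 + size ds + size ds + size ds.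
Proof. by rewrite !size_cat !size_map /=; lia. Qed.

Lemma dcel_le (G : plane_graph) (ds : seq (vert G * vert G)) a :
  nth 0 (dcel ds) a <= nv G + size ds.
Proof.
have [ha|ha] := ltnP a (size (dcel ds)); last by rewrite nth_default.
have : nth 0 (dcel ds) a \in dcel ds by apply: mem_nth.
rewrite !mem_cat !inE => /or4P[/or3P[]/eqP->|/mapP[d _ ->]|/mapP[d _ ->]|/mapP[d _ ->]].
- exact: leq_addr.
- exact: leq_addl.
- by apply: leq_trans (index_size _ _) (leq_addl _ _).
- by apply: leq_trans (ltnW (ltn_ord _)) (leq_addr _ _).
- by apply: leq_trans (index_size _ _) (leq_addl _ _).
by apply: leq_trans (index_size _ _) (leq_addl _ _).
Qed.

Lemma dcel_okP (G : plane_graph) (ds : seq (vert G * vert G)) :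
  dart_numbering ds -> dcel_ok ds (nth 0 (dcel ds)).
Proof.
have shift (s1 s2 : seq nat) i : nth 0 (s1 ++ s2) (size s1 + i) = nth 0 s2 i.
  by rewrite nth_cat ltnNge leq_addr /= addKn.
case=> _ E; have sz (f : vert G * vert G -> nat) : size ds = size [seq f d | d <- ds] by rewrite size_map.
split=> d; rewrite /dart -E => dd; rewrite -!addnA (shift [:: _; _; _]).
  rewrite [X in X + _](sz (fun d => val d.1)) shift nth_cat size_map index_mem dd.
  by rewrite (nth_map d) ?index_mem // nth_index.
rewrite [X in X + _](sz (fun d => val d.1)) shift.
rewrite [X in X + _](sz (fun d => index (d.2, d.1) ds)) shift.
by rewrite (nth_map d) ?index_mem // nth_index.
Qed.

(** The search starts on the inner side of the given outer dart and stops at one of the two ends of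
    the chain; the walk from that end passes all inner faces. *)
Lemma chain_code_correct (G : plane_graph) (ds : seq (vert G * vert G)) (T W : nat) :
  even_polygonal_chain G -> dart_numbering ds ->
  nv G + 8 * size ds + 8 <= W -> 100 * size ds + 100 <= T ->
  exists out : seq nat, [/\ uniq out, out =i spec_af G
    & computes_within chain_code T W (dcel ds) out].
Proof.
move=> epc dsP hW hT; have [tc [col colP] op _] := epc.
have mW : 8 * size ds + 8 <= W by lia.
pose d0 := twin (outer_dart G).
have a0 : dart d0 by rewrite dart_twin; apply: outer_dartP.
have f0 : face d0 != outer_face G by exact: (twin_outer tc (outer_dartP G) erefl).
have [n0 [en0 nb0]] := walk_stops tc op a0 f0.
have cn0 i : i < n0 -> chord (next_chord (walk d0 i)).
  by move=> ni; case: (next_chordP (walk d0 i)) => // h; have := nb0 i ni; rewrite h eqxx.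
have [e eE] : exists e, e = walk d0 n0 by exists (walk d0 n0).
have [ae fe] := walk_inner a0 f0 cn0 (leqnn n0); have ee := en0; rewrite -eE in ae fe ee.
have [n cw] := chain_walk_exists tc op ae fe ee.
pose E := ends_at (chain_type e) n.
have nm := chain_length dsP epc cw.
have [[b1 b2 b3 b4] [b5 b6 b7]] := ends_at_le (chain_type e) n.
have hl : highest E <= n.+2 by rewrite /highest geq_max b6 b7.
have ll : lowest E <= n.+2 by rewrite /lowest geq_min b1.
exists (iota (lowest E) ((highest E).+1 - lowest E)); split; first exact: iota_uniq.
  move=> k; rewrite mem_iota (spec_af_range epc cw colP) -/E.
  by apply/idP/idP; lia.
have le_W a : nth 0 (dcel ds) a <= W.
  by apply: leq_trans (dcel_le ds a) _; lia.
apply: (@reach_computes _ _ _ _ _ 19).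
  by split=> [i|a]; [change (nth 0 (nseq 19 0) i <= W); rewrite nth_nseq if_same | apply: le_W].
have Mo := dcel_okP dsP.
(* The marking; 20 = 11 + 9 and 54 = 11 + 43 per dart for the two walks; initialisation and
   output. *)
apply: (@reach_le _ _ _ ((11 * size ds + 11) +
  (20 * size ds + (54 * size ds + (6 * (size ds).+3 + 24).+4.+4)))); first by lia.
apply: reach_bind.
  apply: (marking_run dsP mW Mo) => // d a; rewrite nth_default // size_dcel; exact: leq_addr.
move=> _ [a7 [a9 [M [{}Mo Mm ->]]]].
apply: reach_bind.
  apply: (@reach_le _ _ _ (\sum_(0 <= l < n0.+1) (11 * run (walk d0 l) + 9))).
    apply: (@sum_time G ds (fun l => run (walk d0 l)) 9 d0) => [l|]; first exact: run_le.
    by apply: (walk_faces dsP epc) => // [i /andP[_ /nb0]|/cn0].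
  exact: (search_run dsP mW Mo Mm a0 f0 nb0 en0 (k := n0) (i := 0)).
move=> _ [{}a7 [a8 [{}a9 ->]]]; rewrite -eE.
have l1 := idx_lt dsP ae.
have out R5 R6 R7 R8 R9 R17 R18 : let: Ends lA hA lB hB lD hD lE := E in
    reach chain_code W (139, [:: 0; 1; 3 + size ds; 3 + size ds + size ds;
        3 + size ds + size ds + size ds; R5; R6; R7; R8; R9;
        lA; hA; lB; hB; lD; hD; lE; R17; R18], M) (6 * ((highest E).+1 - lowest E) + 13)
      (fun c => [/\ size chain_code <= c.1.1,
        nth 0 c.1.2 0 = size (iota (lowest E) ((highest E).+1 - lowest E))
      & forall i, i < size (iota (lowest E) ((highest E).+1 - lowest E)) ->
        c.2 (nth 0 c.1.2 1 + i) = nth 0 (iota (lowest E) ((highest E).+1 - lowest E)) i]).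
  rewrite size_iota; have := lowest_gt0 (chain_type e) n; rewrite -/E.
  have bW : (highest E).+1 + lowest E <= W by lia.
  case: (E) bW => lA hA lB hB lD hD lE bW lo0; rewrite -[X in reach _ _ _ X _]addn0.
  apply: reach_bind; first exact: output_run bW lo0.
  move=> c [c1 c2 c3]; apply: reach_done; split=> // i io.
  by rewrite nth_iota // c3.
apply: (@reach_le _ _ _ ((54 * size ds + (6 * ((highest E).+1 - lowest E) + 13)).+4.+4.+3)); first by lia.
do 9 exec_step; rewrite Mm //; apply: exec_Jz; first reflexivity.
cbn [nth]; have [_ _ ne ce _] := cw; have ec : chord e = (face (twin e) != outer_face G).
  by rewrite /chord ae fe.
(* A single inner face: its entry dart is marked, and the program goes from [ends0] straight to the
   output. *)
case: (posnP n) => n0'.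
  have -> : face (twin e) == outer_face G by apply/negPn; rewrite -ec ce n0'.
  cbn [nat_of_bool eq_op]; apply: exec_Jz; first reflexivity.
  apply: reach_le (leq_addl _ _) _.
  by have := out (index e ds) (index e ds) 1 a8 a9 (index (outer_dart G) ds) 0; rewrite /E n0'.
have -> : face (twin e) == outer_face G = false by apply/negbTE; rewrite -ec ce.
cbn [nat_of_bool eq_op]; apply: (@reach_le _ _ _ _ _ _ (leqnSn _)).
apply: reach_bind.
  apply: (@reach_le _ _ _ (\sum_(1 <= l < n.+1) (11 * run (walk e l) + 43))).
    apply: leq_trans (_ : \sum_(0 <= l < n.+1) (11 * run (walk e l) + 43) <= _).
      by rewrite [X in _ <= X]big_ltn // leq_addl.
    apply: (@sum_time G ds (fun l => run (walk e l)) 43 e) => [l|]; first exact: run_le.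
    exact: (chain_faces dsP epc cw).
  have := @chain_run G ds dsP W mW epc e n cw col M colP Mo Mm n.-1 0 (index e ds).
  by rewrite /= ne; apply; rewrite add0n prednK.
move=> c [R5 [R6 [R7 [R8 [R9 [R17 [R18 ]]]]]]]; have := out R5 R6 R7 R8 R9 R17 R18.
by rewrite -/E; case: (E) => lA hA lB hB lD hD lE H ->.
Qed.

Theorem corollary4p16 :
  exists (P : program) (c : nat),
  forall (G : plane_graph) (ds : seq (vert G * vert G)),
    even_polygonal_chain G -> dart_numbering ds ->
    exists out : seq nat,
      [/\ uniq out, out =i spec_af G
        & computes_within P (c * gsize G) (gsize G ^ c) (dcel ds) out].
Proof.
(* The constant is kept abstract so that no power with exponent 300 is ever evaluated. *)
have [c c300] : exists c, 300 <= c by exists 300.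
exists chain_code, c => G ds epc dsP; apply: chain_code_correct => //.
all: have := card_darts G; rewrite (card_darts_size dsP) => md.
all: have [tc _ _ _] := epc; have [n2 _ _] := and3P tc.
all: rewrite /gsize; move: (#|edges G|) md => k md; move: (nv G) (size ds) n2 md => n m n2 md.
  (* The word bound is linear and there are at least 3 vertices, so the factor [3 ^ 4] contained in
     the fifth power is ample. *)
  apply: leq_trans (_ : (n + k) ^ 5 <= _); last by apply: leq_pexp2l; lia.
  have h : 3 <= n + k by lia.
  rewrite expnS; apply: leq_trans (_ : (n + k) * 3 ^ 4 <= _); first by lia.
  by rewrite leq_mul2l leq_exp2r // h orbT.
by apply: leq_trans (_ : 300 * (n + k) <= _); [lia | rewrite leq_mul2r c300 orbT].
Qed.
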